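(* Let $\hat{\mathcal O}\subset\mathbb R^n$ be a bounded, connected Lipschitz domain, let $F\hat x=x_0+B\hat x$ with $x_0\in\mathbb R^n$ and $B\in\mathbb R^{n\times n}$ invertible, and let $\mathcal O=F(\hat{\mathcal O})$. Let $k(s,\hat{\mathcal O})$, $K(s,\hat{\mathcal O})$ and $C_{\rm PF,I}(s,\hat{\mathcal O})$ be the constants on $\hat{\mathcal O}$ described in the context. Then for every $s\in(0,1)$ and every $v\in H^s(\mathcal O)$: (i) $$|v|_{L^2(\mathcal O),H^1(\mathcal O),s}^2\le\|B^{-1}\|^{2s}\max\{|\det B|^{-1}\|B\|^{n+2s},1\}\;k(s,\hat{\mathcal O})^{-2}\,|v|_{s,\mathcal O,\inf}^2;$$ (ii) $$|v|_{s,\mathcal O,\inf}^2\le\|B\|^{2s}\max\{|\det B|\,\|B^{-1}\|^{n+2s},1\}\;K(s,\hat{\mathcal O})^2\Bigl(3+\frac{C_{\rm PF,I}(s,\hat{\mathcal O})^2}{s(1-s)}\Bigr)|v|_{L^2(\mathcal O),H^1(\mathcal O),s}^2.$$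
   Context: Functions are real valued. For a bounded connected Lipschitz domain $\mathcal O\subset\mathbb R^n$, $\|\cdot\|_{0,\mathcal O}$ is the $L^2(\mathcal O)$-norm, $|v|_{1,\mathcal O}=\|\nabla v\|_{0,\mathcal O}$, and $\|v\|_{1,\mathcal O}^2=\|v\|_{0,\mathcal O}^2+|v|_{1,\mathcal O}^2$. For $0<s<1$: - Sobolev-Slobodeckij semi-norm: $|v|_{s,\mathcal O}=\Bigl(\int_{\mathcal O}\int_{\mathcal O}\frac{|v(x)-v(y)|^2}{|x-y|^{n+2s}}\,dx\,dy\Bigr)^{1/2}$; norm: $\|v\|_{s,\mathcal O}=\bigl(\|v\|_{0,\mathcal O}^2+|v|_{s,\mathcal O}^2\bigr)^{1/2}$. $H^s(\mathcal O)$ is the space of $v\in L^2(\mathcal O)$ with $\|v\|_{s,\mathcal O}<\infty$. - Quotient space semi-norm: $|v|_{s,\mathcal O,\inf}=\inf_{c\in\mathbb R}\|v+c\|_{s,\mathcal O}$. - Interpolation norm: $\|v\|_{L^2(\mathcal O),H^1(\mathcal O),s}=\Bigl(\int_0^\infty t^{-2s}\inf_{v=v_0+v_1}\bigl(\|v_0\|_{0,\mathcal O}^2+t^2\|v_1\|_{1,\mathcal O}^2\bigr)\frac{dt}{t}\Bigr)^{1/2}$. - Interpolation semi-norm: $|v|_{L^2(\mathcal O),H^1(\mathcal O),s}=\Bigl(\int_0^\infty t^{-2s}\inf_{v=v_0+v_1}\bigl(\|v_0\|_{0,\mathcal O}^2+t^2|v_1|_{1,\mathcal O}^2\bigr)\frac{dt}{t}\Bigr)^{1/2}$.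 The infima are over $v_0\in L^2(\mathcal O)$, $v_1\in H^1(\mathcal O)$ with $v_0+v_1=v$. For matrices, $\|\cdot\|$ is the operator norm induced by the Euclidean norm. Constants on a bounded connected Lipschitz domain $\mathcal O$, for given $s\in(0,1)$: - $k(s,\mathcal O),K(s,\mathcal O)>0$ are constants (which exist) such that $k(s,\mathcal O)\|w\|_{L^2(\mathcal O),H^1(\mathcal O),s}\le\|w\|_{s,\mathcal O}\le K(s,\mathcal O)\|w\|_{L^2(\mathcal O),H^1(\mathcal O),s}$ for all $w\in H^s(\mathcal O)$. - $C_{\rm PF,I}(s,\mathcal O)>0$ is a constant (which exists) such that $\|w\|_{0,\mathcal O}\le C_{\rm PF,I}(s,\mathcal O)\bigl(|w|_{L^2(\mathcal O),H^1(\mathcal O),s}+|\int_{\mathcal O}w|\bigr)$ for all $w\in H^s(\mathcal O)$. *)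

(* Defs.v *)
From HB Require Import structures.
From mathcomp Require Import all_boot all_order all_algebra.
From mathcomp Require Import all_classical all_reals all_analysis.

Set Implicit Arguments.
Unset Strict Implicit.
Unset Printing Implicit Defensive.

Import Order.TTheory GRing.Theory Num.Theory.
Import numFieldNormedType.Exports.

Local Open Scope classical_set_scope.
Local Open Scope ring_scope.

Section euclidean.
Context {R : realType} {n : nat}.
Implicit Types (x y : 'cV[R]_n).

Definition dotcv x y : R := \sum_(i < n) x i ord0 * y i ord0.

(* The library norm `|x| on matrices is the sup norm of the entries. *)
Definition enorm x : R := Num.sqrt (dotcv x x).

Definition opnorm (B : 'M[R]_n) : R :=
  sup [set enorm (B *m x) | x in [set x | enorm x <= 1]].

Definition affine (x0 : 'cV[R]_n) (B : 'M[R]_n) x : 'cV[R]_n := x0 + B *m x.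

End euclidean.

(* Around each boundary point, in suitable orthonormal coordinates, the set
   coincides with the strict epigraph of a Lipschitz function.  The direction
   of the last coordinate axis is e, and y - (e . y) e is the orthogonal
   projection of y on the hyperplane of the other coordinates.  Lipschitz
   continuity for the sup norm and for the Euclidean norm are the same. *)
Definition lipschitz_boundary (R : realType) (n : nat) (O : set 'cV[R]_n) :=
  forall x, (closure O `\` O°) x ->
  exists (r : R) (e : 'cV[R]_n) (g : 'cV[R]_n -> R),
  [/\ 0 < r, enorm e = 1, lipschitz g &
      forall y, enorm (y - x) < r ->
        O y <-> g (y - dotcv e y *: e) < dotcv e y].

Definition lipschitz_domain (R : realType) (n : nat) (O : set 'cV[R]_n) :=
  [/\ O !=set0, open O, connected O, bounded_set O & lipschitz_boundary O].

(* The sigma-algebra on R^n generated by the coordinates, that is, the Borel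
   sigma-algebra; same construction as for n.-tuple in the library. *)
Definition cV_display : measure_display. Proof. exact: default_measure_display. Qed.

Section measurable_cV.
Context {R : realType} {n : nat}.

Definition measurable_cV : set (set 'cV[R]_n) :=
  g_sigma_preimage (fun (i : 'I_n) (x : 'cV[R]_n) => x i ord0).

Let measurable_cV0 : measurable_cV set0.
Proof. exact: sigma_algebra0. Qed.

Let measurable_cVC A : measurable_cV A -> measurable_cV (~` A).
Proof. exact: sigma_algebraC. Qed.

Let measurable_cV_bigcup (F : _^nat) : (forall i, measurable_cV (F i)) ->
  measurable_cV (\bigcup_i F i).
Proof. exact: sigma_algebra_bigcup. Qed.

HB.instance Definition _ := @isMeasurable.Build cV_display
  'cV[R]_n measurable_cV measurable_cV0 measurable_cVC measurable_cV_bigcup.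

End measurable_cV.

Section coordinates.
Context {R : realType}.

Lemma measurable_coor n (i : 'I_n) :
  measurable_fun [set: 'cV[R]_n] (fun x : 'cV[R]_n => x i ord0).
Proof.
move=> _ Y mY; rewrite setTI; apply: sub_sigma_algebra => /=.
rewrite -bigcup_seq/=; exists i => /=; first by rewrite mem_index_enum.
by exists Y => //; rewrite setTI.
Qed.

Lemma measurable_fun_coorP d (T : measurableType d) n (f : T -> 'cV[R]_n) :
  (forall i, measurable_fun [set: T] (fun t => f t i ord0)) ->
  measurable_fun [set: T] f.
Proof.
move=> mf _ A mA; rewrite setTI; move: A mA.
apply: smallest_sub.
  split => /=; first by rewrite preimage_set0.
  - by move=> A mA; rewrite setTD preimage_setC; exact: measurableC.
  - by move=> F mF; rewrite preimage_bigcup; exact: bigcup_measurable.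
rewrite -bigcup_seq => A [i _ [B mB <-]] /=; rewrite setTI.
by rewrite -[X in measurable X]setTI; exact: mf.
Qed.

Definition cV_cons n (p : measurableTypeR R * 'cV[R]_n) : 'cV[R]_n.+1 :=
  col_mx (p.1 : R)%:M p.2.

Definition cV_uncons n (x : 'cV[R]_n.+1) : measurableTypeR R * 'cV[R]_n :=
  (x ord0 ord0, \col_i x (lift ord0 i) ord0).

Lemma cV_cons0 n (p : measurableTypeR R * 'cV[R]_n) :
  cV_cons p ord0 ord0 = p.1.
Proof.
have -> : (ord0 : 'I_n.+1) = lshift n (@ord0 0) by apply: val_inj.
by rewrite /cV_cons; exact: (etrans (@col_mxEu R 1 n 1 _ _ _ _)) (mxE _ _ _ _).
Qed.

Lemma cV_consS n (p : measurableTypeR R * 'cV[R]_n) i :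
  cV_cons p (lift ord0 i) ord0 = p.2 i ord0.
Proof.
have -> : lift ord0 i = rshift 1 i by apply: val_inj.
exact: (@col_mxEd R 1 n 1).
Qed.

Lemma cV_consK n : cancel (@cV_cons n) (@cV_uncons n).
Proof.
move=> [a x]; rewrite /cV_uncons cV_cons0; congr pair.
by apply/colP => i; rewrite mxE cV_consS.
Qed.

Lemma measurable_cV_cons n :
  measurable_fun [set: measurableTypeR R * 'cV[R]_n] (@cV_cons n).
Proof.
apply: measurable_fun_coorP => i.
have [j ->|->] := unliftP ord0 i.
- rewrite (_ : (fun t => _) = (fun x : 'cV[R]_n => x j ord0) \o snd); last first.
    by apply/funext => t; rewrite cV_consS.
  exact: measurableT_comp (measurable_coor j) measurable_snd.
- rewrite (_ : (fun t => _) = fst); last by apply/funext => t; rewrite cV_cons0.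
  exact: measurable_fst.
Qed.

Lemma measurable_cV_uncons n :
  measurable_fun [set: 'cV[R]_n.+1] (@cV_uncons n).
Proof.
apply/measurable_fun_pairP; split => /=.
  exact: (measurable_coor (@ord0 n)).
apply: measurable_fun_coorP => i.
rewrite (_ : (fun t => _) = (fun x : 'cV[R]_n.+1 => x (lift ord0 i) ord0)).
  exact: measurable_coor.
by apply/funext => t /=; rewrite mxE.
Qed.

End coordinates.

Section cons_measure.
Context {R : realType} (n : nat).
Variable mu : {sigma_finite_measure set 'cV[R]_n -> \bar R}.

(* image of the product measure under R x R^n ~ R^(n+1) *)
Definition cons_measure : set 'cV[R]_n.+1 -> \bar R :=
  pushforward (@lebesgue_measure R \x mu)%E (@cV_cons R n).

Let cons_measure0 : cons_measure set0 = 0%E.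
Proof. by rewrite /cons_measure /pushforward preimage_set0 measure0. Qed.

Let cons_measure_ge0 A : (0 <= cons_measure A)%E.
Proof. by rewrite /cons_measure /pushforward measure_ge0. Qed.

Let cons_measure_sigma_additive : semi_sigma_additive cons_measure.
Proof.
move=> F mF tF mUF; rewrite /cons_measure /pushforward preimage_bigcup.
apply: measure_semi_sigma_additive.
- by move=> i; rewrite -[X in measurable X]setTI; exact: measurable_cV_cons.
- apply/trivIsetP => /= i j _ _ ij; rewrite -preimage_setI.
  by move/trivIsetP : tF => /(_ _ _ _ _ ij) ->//; rewrite preimage_set0.
- rewrite -preimage_bigcup -[X in measurable X]setTI.
  exact: measurable_cV_cons.
Qed.

HB.instance Definition _ := isMeasure.Build _ _ _ cons_measure
  cons_measure0 cons_measure_ge0 cons_measure_sigma_additive.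

Let cons_measure_sigma_finite : sigma_finite setT cons_measure.
Proof.
have /sigma_finiteP[F [TF ndF Foo]] := sigma_finiteT (@lebesgue_measure R).
have /sigma_finiteP[G [TG ndG Goo]] := sigma_finiteT mu.
have mFG k : measurable (F k `*` G k).
  by apply: measurableX; [have [] := Foo k|have [] := Goo k].
exists (fun k => @cV_uncons R n @^-1` (F k `*` G k)).
  apply/esym/seteqP; split => // x _.
  have [i _ Fi] : (\bigcup_i F i) (cV_uncons x).1 by rewrite -TF.
  have [j _ Gj] : (\bigcup_i G i) (cV_uncons x).2 by rewrite -TG.
  exists (maxn i j) => //; split.
    by move: Fi; exact/subsetPset/ndF/leq_maxl.
  by move: Gj; exact/subsetPset/ndG/leq_maxr.
move=> k; split.
  by rewrite -[X in measurable X]setTI; exact: measurable_cV_uncons.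
rewrite /cons_measure /pushforward -comp_preimage.
rewrite (_ : _ \o _ = id); last by apply/funext => p /=; rewrite cV_consK.
have [? ?] := Foo k; have [? ?] := Goo k.
by rewrite product_measure1E// lte_mul_pinfty// ge0_fin_numE.
Qed.

HB.instance Definition _ := Measure_isSigmaFinite.Build _ _ _ cons_measure
  cons_measure_sigma_finite.

End cons_measure.

Fixpoint lebesgue_cV (R : realType) (n : nat) :
    {sigma_finite_measure set 'cV[R]_n -> \bar R} :=
  match n with
  | 0 => dirac (0 : 'cV[R]_0)
  | n'.+1 => cons_measure (lebesgue_cV R n')
  end.

Section smooth.
Context {R : realType} {n : nat}.

(* Differentiability at every point, iterated on the directional derivatives,
   amounts to continuity of the partial derivatives of all orders. *)
Fixpoint differentiable_upto (m : nat) (f : 'cV[R]_n -> R) : Prop :=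
  match m with
  | 0 => continuous f
  | m'.+1 => (forall x, differentiable f x) /\
             forall u, differentiable_upto m' (fun x => 'D_u f x)
  end.

Definition smooth (f : 'cV[R]_n -> R) := forall m, differentiable_upto m f.

Definition test_function (O : set 'cV[R]_n) (phi : 'cV[R]_n -> R) :=
  let supp := closure [set x | phi x != 0] in
  [/\ smooth phi, compact supp & supp `<=` O].

Definition partial (i : 'I_n) (f : 'cV[R]_n -> R) (x : 'cV[R]_n) : R :=
  'D_(delta_mx i ord0) f x.

End smooth.

Section function_spaces.
Context {R : realType} {n : nat}.
Local Notation mu := (lebesgue_cV R n).
Implicit Types (O : set 'cV[R]_n) (v : 'cV[R]_n -> R) (s t : R).

(* Elements of function spaces on O are represented by total functions, of
   which only the restriction to O matters; (semi-)norms take values in the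
   extended reals. *)
Definition l2norm O v : \bar R :=
  sqrte (\int[mu]_(x in O) ((v x) ^+ 2)%:E)%E.

Definition L2 O v := measurable_fun O v /\ (l2norm O v < +oo)%E.

Definition weak_gradient O v (g : 'cV[R]_n -> 'cV[R]_n) :=
  forall phi, test_function O phi -> forall i : 'I_n,
  \int[mu]_(x in O) (v x * partial i phi x) =
  - \int[mu]_(x in O) (g x i ord0 * phi x).

(* An element of H^1(O), together with its weak gradient, which is unique up
   to equality almost everywhere. *)
Record H1 O := MkH1 {
  H1_fun :> 'cV[R]_n -> R;
  H1_grad : 'cV[R]_n -> 'cV[R]_n;
  H1_L2 : L2 O H1_fun;
  H1_grad_L2 : forall i, L2 O (fun x => H1_grad x i ord0);
  H1_weak_gradient : weak_gradient O H1_fun H1_grad }.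

Definition H1_seminorm O (w : H1 O) : \bar R := l2norm O (enorm \o H1_grad w).

Definition H1_norm O (w : H1 O) : \bar R :=
  sqrte (l2norm O w ^+ 2 + H1_seminorm w ^+ 2)%E.

(* The integrand is 0 at x = y. *)
Definition slobodeckij_seminorm s O v : \bar R :=
  sqrte (\int[mu]_(x in O) \int[mu]_(y in O)
    (`|v x - v y| ^+ 2 / enorm (x - y) `^ (n%:R + 2 * s))%:E)%E.

Definition Hs_norm s O v : \bar R :=
  sqrte (l2norm O v ^+ 2 + slobodeckij_seminorm s O v ^+ 2)%E.

Definition Hs s O v := L2 O v /\ (Hs_norm s O v < +oo)%E.

Definition quotient_seminorm s O v : \bar R :=
  ereal_inf [set Hs_norm s O (fun x => v x + c) | c in [set: R]].

Definition decomposition O v (v0 : 'cV[R]_n -> R) (v1 : H1 O) :=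
  L2 O v0 /\ {ae mu, forall x, O x -> v x = v0 x + v1 x}.

Definition Kfun_norm t O v : \bar R :=
  ereal_inf [set z | exists v0 (v1 : H1 O), decomposition v v0 v1 /\
    z = (l2norm O v0 ^+ 2 + (t ^+ 2)%:E * H1_norm v1 ^+ 2)%E].

Definition Kfun_seminorm t O v : \bar R :=
  ereal_inf [set z | exists v0 (v1 : H1 O), decomposition v v0 v1 /\
    z = (l2norm O v0 ^+ 2 + (t ^+ 2)%:E * H1_seminorm v1 ^+ 2)%E].

Definition interpolation_norm s O v : \bar R :=
  sqrte (\int[lebesgue_measure]_(t in `]0%R, +oo[)
    ((t `^ (- (2 * s)))%:E * Kfun_norm t O v * (t^-1)%:E))%E.

Definition interpolation_seminorm s O v : \bar R :=
  sqrte (\int[lebesgue_measure]_(t in `]0%R, +oo[)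
    ((t `^ (- (2 * s)))%:E * Kfun_seminorm t O v * (t^-1)%:E))%E.

End function_spaces.

Definition norm_equivalence_constants (R : realType) (n : nat) (s : R)
    (O : set 'cV[R]_n) (k K : R) :=
  [/\ 0 < k, 0 < K & forall w, Hs s O w ->
    (k%:E * interpolation_norm s O w <= Hs_norm s O w)%E /\
    (Hs_norm s O w <= K%:E * interpolation_norm s O w)%E].

Definition poincare_friedrichs_constant (R : realType) (n : nat) (s : R)
    (O : set 'cV[R]_n) (C : R) :=
  0 < C /\ forall w, Hs s O w ->
    (l2norm O w <= C%:E * (interpolation_seminorm s O w
      + `| \int[lebesgue_cV R n]_(x in O) (w x)%:E |))%E.

(* Main.v *)
(* Pull v back to vh = v o F on the reference domain, F = x0 + B.  The squared
   L^2 norm scales exactly by |det B|^-1, the squared Slobodeckij seminorm by at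
   most |det B|^-2 ||B||^(n+2s), and, since the gradient of a pullback is
   B^T (grad v) o F, the K-functional satisfies
   K(t, vh) <= |det B|^-1 K(||B|| t, v); rescaling t shows that the squared
   interpolation seminorm scales by at most |det B|^-1 ||B||^(2s).  The same
   bounds for F^-1 go the other way.
   (i) The interpolation seminorm ignores constants and is at most the
   interpolation norm, to which the constant k applies on the reference domain.
   (ii) Choose c such that w = vh + c has mean value 0.  The interpolation norm of
   w is controlled by its seminorm and by ||w||_0: for t < 1 every decomposition
   w = w0 + w1 satisfies ||w1||_0^2 <= 2 ||w||_0^2 + 2 ||w0||_0^2, and for t > 1
   one takes w1 = 0; finally ||w||_0 is bounded by the Poincare-Friedrichs
   constant.
   The change of variables itself comes from Fubini for block triangular matrices
   and from a factorization of B into such matrices. *)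
Require Import Defs.
From mathcomp Require Import all_boot all_order all_algebra.
From mathcomp Require Import all_classical all_reals all_analysis.
From mathcomp Require Import measurable_realfun ring lra.

Set Implicit Arguments.
Unset Strict Implicit.
Unset Printing Implicit Defensive.

Import Order.TTheory GRing.Theory Num.Theory.
Import numFieldNormedType.Exports.

Local Open Scope classical_set_scope.
Local Open Scope ring_scope.

(** * Linear change of variables for Lebesgue measure *)

(** Outside the maxima no determinant appears, because each estimate goes to the reference domain
    and back: [|det B|^-1] of one direction cancels [|det B|] of the other. The maximum is what
    remains after this common factor is split off: the squared L^2 part leaves 1, the squared
    Slobodeckij part leaves |det B|^-1 ||B||^(n+2s). In 3 + C^2/(s(1-s)), 3 = 1 + 2: for t <= 1 the
    term t^2 ||w1||_0^2 costs 2 ||w0||_0^2 on top of ||w0||_0^2. The remaining 2 t^2 ||w||_0^2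
    integrates to ||w||_0^2/(1-s), the range t > 1 adds ||w||_0^2/(2s), and together they are at
    most ||w||_0^2/(s(1-s)). That the seminorm ignores constants rests on a fact about test
    functions: adding c to an element of H^1 keeps its weak gradient because partial derivatives of
    test functions have integral 0, which is derived from translation invariance and dominated
    convergence. Scaling and comparing the integrals over t uses measurability of the K-functionals,
    which are infima over uncountable families; it comes from their monotonicity in t. *)

Lemma lebesgue_measure_affine (R : realType) (a b : R) (A : set R) :
  a != 0 -> measurable A ->
  (`|a|%:E * pushforward (@lebesgue_measure R)
    ((fun x : R => (a * x + b)%R) : _ -> measurableTypeR R) A)%E = lebesgue_measure A.
Proof.
move=> a0 mA.
have mf : measurable_fun [set: measurableTypeR R]
    ((fun x => a * x + b) : _ -> measurableTypeR R).
  by apply: measurable_funD => //; apply: measurable_funM.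
apply/esym.
(* Lebesgue measure is determined by its values on half-open intervals, so it suffices to evaluate
   [m] there. *)
pose m := mscale (NngNum (normr_ge0 a))
    (measure_function_pushforward__canonical__measure_function_Measure lebesgue_measure
        mf).
rewrite (@lebesgue_measure_unique R m)// => _ [[c d]] _ <-/=.
rewrite /m /mscale/= /pushforward.
case: (ltgtP a 0) a0 => // a0 _.
(* A negative slope swaps the open and the closed end, which leaves the length unchanged. *)
- rewrite (_ : _ @^-1` _ = `[(d - b) / a, (c - b) / a[%classic); last first.
    apply/seteqP; split => x /=; rewrite !in_itv/= ler_ndivrMr// ltr_ndivlMr// =>
        /andP[? ?]; apply/andP; split; lra.
  rewrite !lebesgue_measure_itv/= !lte_fin ltr_ndivrMr// divfK ?lt_eqF//.
  rewrite ltrD2r; case: ifPn => cd; last by rewrite mule0.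
  rewrite -!EFinD -EFinM ltr0_norm//; congr EFin; field; by rewrite lt_eqF.
- rewrite (_ : _ @^-1` _ = `](c - b) / a, (d - b) / a]%classic); last first.
    apply/seteqP; split => x /=; rewrite !in_itv/= ler_pdivlMr// ltr_pdivrMr// =>
        /andP[? ?]; apply/andP; split; lra.
  rewrite !lebesgue_measure_itv/= !lte_fin ltr_pdivrMr// divfK ?gt_eqF//.
  rewrite ltrD2r; case: ifPn => cd; last by rewrite mule0.
  rewrite -!EFinD -EFinM gtr0_norm//; congr EFin; field; by rewrite gt_eqF.
Qed.

Lemma ge0_integral_affine (R : realType) (a b : R) (f : R -> \bar R) :
  a != 0 -> measurable_fun [set: R] f -> (forall x, 0 <= f x)%E ->
  (\int[lebesgue_measure]_x f (a * x + b)%R =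
   `|a|^-1%:E * \int[lebesgue_measure]_x f x)%E.
Proof.
move=> a0 mf f0.
have mg : measurable_fun [set: measurableTypeR R]
    ((fun x => a * x + b) : _ -> measurableTypeR R).
  by apply: measurable_funD => //; apply: measurable_funM.
have [m mE] : {m : {measure set (measurableTypeR R) -> \bar R} | 
    m = pushforward (@lebesgue_measure R) ((fun x => a * x + b) : _ -> measurableTypeR
        R) :> (set _ -> _)}.
  by exists (measure_function_pushforward__canonical__measure_function_Measure
      lebesgue_measure mg).
transitivity (\int[m]_x f x)%E.
  rewrite mE ge0_integral_pushforward//.
rewrite [in RHS](eq_measure_integral (mscale (NngNum (normr_ge0 a)) m)); last first.
  by move=> A mA _; rewrite /= /mscale/= mE lebesgue_measure_affine.
rewrite ge0_integral_mscale//= muleA -EFinM mulVf ?normr_eq0// mul1e//.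
Qed.

Lemma ge0_integral_cV_cons (R : realType) n (f : 'cV[R]_n.+1 -> \bar R) :
  measurable_fun [set: 'cV[R]_n.+1] f -> (forall x, 0 <= f x)%E ->
  (\int[lebesgue_cV R n.+1]_x f x =
   \int[@lebesgue_measure R]_a \int[lebesgue_cV R n]_x f (cV_cons (a, x)))%E.
Proof.
move=> mf f0.
transitivity (\int[@lebesgue_measure R \x lebesgue_cV R n]_z f (cV_cons z))%E.
  by rewrite [LHS](ge0_integral_pushforward (@measurable_cV_cons R n)).
rewrite fubini_tonelli1//.
by apply: measurableT_comp => //; exact: measurable_cV_cons.
Qed.

(** Both orders of integration are needed: an upper triangular block map shifts the head by an
    amount depending on the tail, so the head must be the inner variable; for a lower triangular one
    it is the other way round. *)
Lemma ge0_integral_cV_consC (R : realType) n (f : 'cV[R]_n.+1 -> \bar R) :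
  measurable_fun [set: 'cV[R]_n.+1] f -> (forall x, 0 <= f x)%E ->
  (\int[lebesgue_cV R n.+1]_x f x =
   \int[lebesgue_cV R n]_x \int[@lebesgue_measure R]_a f (cV_cons (a, x)))%E.
Proof.
move=> mf f0; rewrite ge0_integral_cV_cons//.
apply: (@fubini_tonelli _ _ _ _ _ _ _ (f \o @cV_cons R n)) => [|x]; last exact: f0.
by apply: measurableT_comp => //; exact: measurable_cV_cons.
Qed.

Lemma measurable_mulmx (R : realType) m n (B : 'M[R]_(m, n)) :
  measurable_fun [set: 'cV[R]_n] (mulmx B : 'cV[R]_n -> 'cV[R]_m).
Proof.
apply: measurable_fun_coorP => i.
under eq_fun do rewrite mxE.
apply: measurable_sum => j; apply: measurable_funM => //.
exact: measurable_coor.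
Qed.

Lemma measurable_addcV (R : realType) n (y : 'cV[R]_n) :
  measurable_fun [set: 'cV[R]_n] (fun x => y + x).
Proof.
apply: measurable_fun_coorP => i; under eq_fun do rewrite mxE.
by apply: measurable_funD => //; exact: measurable_coor.
Qed.

Lemma cV_consD (R : realType) n (y : 'cV[R]_n.+1) (p : measurableTypeR R * 'cV[R]_n) :
  y + cV_cons p = cV_cons ((cV_uncons y).1 + p.1, (cV_uncons y).2 + p.2).
Proof.
apply/colP => i; rewrite mxE.
by have [j ->|->] := unliftP ord0 i; rewrite ?cV_consS ?cV_cons0 ?mxE.
Qed.

(** Induction on the dimension: the tail is translated by the induction hypothesis, the head by the
    one-dimensional affine formula with slope 1. *)
Lemma ge0_integral_translate (R : realType) n (y : 'cV[R]_n)
    (f : 'cV[R]_n -> \bar R) :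
  measurable_fun [set: 'cV[R]_n] f -> (forall x, 0 <= f x)%E ->
  (\int[lebesgue_cV R n]_x f (y + x)%R = \int[lebesgue_cV R n]_x f x)%E.
Proof.
elim: n y f => [|n IH] y f mf f0.
  by apply: eq_integral => x _; congr f; apply/colP => -[].
have mfy : measurable_fun [set: 'cV[R]_n.+1] (fun x => f (y + x)).
  by apply: measurableT_comp => //; exact: measurable_addcV.
rewrite [LHS](ge0_integral_cV_cons mfy (fun x => f0 _)) [RHS](ge0_integral_cV_cons mf f0).
set c := cV_uncons y.
transitivity (\int[@lebesgue_measure R]_a \int[lebesgue_cV R n]_x
   f (cV_cons (1 * a + c.1, x)%R))%E.
  apply: eq_integral => a _; rewrite -[RHS](IH c.2)//.
    by apply: eq_integral => x _; rewrite cV_consD mul1r addrC.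
  apply: measurableT_comp => //.
  apply: (measurableT_comp (@measurable_cV_cons R n)) => //.
rewrite (@ge0_integral_affine R 1 c.1 (fun a => \int[lebesgue_cV R n]_x f (cV_cons (a,
    x))))%E//.
- by rewrite normr1 invr1 mul1e.
- apply: (measurable_fun_fubini_tonelli_F (f \o @cV_cons R n)) => //.
  by apply: measurableT_comp => //; exact: measurable_cV_cons.
- by move=> z; exact: f0.
- by move=> a; apply: integral_ge0 => x _; exact: f0.
Qed.

Lemma measurable_cV_cons2 (R : realType) n d (T : measurableType d)
    (a : T -> measurableTypeR R) (x : T -> 'cV[R]_n) :
  measurable_fun [set: T] a -> measurable_fun [set: T] x ->
  measurable_fun [set: T] (fun t => cV_cons (a t, x t)).
Proof.
move=> ma mx; apply: (measurableT_comp (@measurable_cV_cons R n)).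
exact: measurable_fun_pair.
Qed.

Lemma mulmx_cV_cons (R : realType) n (a : R) (b : 'rV[R]_n) (c : 'cV[R]_n)
    (D : 'M[R]_n) (p : measurableTypeR R * 'cV[R]_n) :
  (block_mx a%:M b c D : 'M[R]_n.+1) *m cV_cons p =
  cV_cons (a * p.1 + (b *m p.2) ord0 ord0, (p.1 : R) *: c + D *m p.2).
Proof.
rewrite /cV_cons (@mul_block_col _ 1 n 1 n 1)/=; apply: (f_equal2 (@col_mx R 1 n 1)).
  by apply/matrixP => i j; rewrite !ord1 -scalar_mxM !mxE.
by rewrite mul_mx_scalar.
Qed.

(** With the determinant as a factor on the left, the property is visibly stable under products of
    matrices. *)
Definition linear_change (R : realType) n (B : 'M[R]_n) :=
  forall f : 'cV[R]_n -> \bar R, measurable_fun [set: 'cV[R]_n] f ->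
  (forall x, 0 <= f x)%E ->
  (`|\det B|%:E * \int[lebesgue_cV R n]_x f (B *m x)%R =
   \int[lebesgue_cV R n]_x f x)%E.

Lemma linear_changeM (R : realType) n (A B : 'M[R]_n) :
  linear_change A -> linear_change B -> linear_change (A *m B).
Proof.
move=> cA cB f mf f0.
rewrite det_mulmx normrM EFinM -muleA.
under eq_integral do rewrite -mulmxA.
rewrite (cB (fun y => f (A *m y)))//; first exact: cA.
by apply: measurableT_comp => //; exact: measurable_mulmx.
Qed.

Lemma linear_change1 (R : realType) n : linear_change (1%:M : 'M[R]_n).
Proof.
move=> f mf f0; rewrite det1 normr1 mul1e.
by apply: eq_integral => x _; rewrite mul1mx.
Qed.

(** For a fixed tail x the head undergoes an affine map of slope [a] and shift b x. Integrating the
    head first removes the shift and leaves a function of D x alone. *)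
Lemma linear_change_ublock (R : realType) n (a : R) (b : 'rV[R]_n) (D : 'M[R]_n) :
  a != 0 -> linear_change D ->
  linear_change (block_mx a%:M b 0 D : 'M[R]_n.+1).
Proof.
move=> a0 cD f mf f0.
rewrite !ge0_integral_cV_consC//; last first.
  by apply: measurableT_comp => //; exact: measurable_mulmx.
pose G x := (\int[@lebesgue_measure R]_a f (cV_cons (a, x)))%E.
have mG : measurable_fun [set: 'cV[R]_n] G.
  apply: (@measurable_fun_fubini_tonelli_G _ _ _ _ R lebesgue_measure (f \o @cV_cons R
      n)).
    by apply: measurableT_comp => //; exact: measurable_cV_cons.
  by move=> z; exact: f0.
have G0 x : (0 <= G x)%E by exact: integral_ge0.
rewrite -[RHS](cD G mG G0).
transitivity (`|\det (block_mx a%:M b 0 D : 'M[R]_n.+1)|%:E *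
  \int[lebesgue_cV R n]_x (`|a|^-1%:E * G (D *m x)%R))%E.
  congr (_ * _)%E; apply: eq_integral => x _.
  rewrite -(@ge0_integral_affine _ _ ((b *m x) ord0 ord0) (fun a => f (cV_cons (a, D *m
      x))))//.
    by apply: eq_integral => y _; rewrite mulmx_cV_cons/= scaler0 add0r.
  by apply: measurableT_comp => //; exact: measurable_cV_cons2.
rewrite ge0_integralZl//; last first.
  by apply: measurableT_comp => //; exact: measurable_mulmx.
rewrite muleA -EFinM (@det_ublock R 1 n) det_scalar1 normrM; congr (_%:E * _)%E.
by rewrite mulrAC divff ?mul1r// normr_eq0.
Qed.

(** For a fixed head t the tail becomes t c + D x: translation invariance removes t c, the
    hypothesis on [D] treats the rest, and the head is finally rescaled by [a]. *)
Lemma linear_change_lblock (R : realType) n (a : R) (c : 'cV[R]_n) (D : 'M[R]_n) :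
  a != 0 -> linear_change D ->
  linear_change (block_mx a%:M 0 c D : 'M[R]_n.+1).
Proof.
move=> a0 cD f mf f0.
rewrite !ge0_integral_cV_cons//; last first.
  by apply: measurableT_comp => //; exact: measurable_mulmx.
pose G (t : R) := (\int[lebesgue_cV R n]_x f (cV_cons (t, x)))%E.
have mG : measurable_fun [set: R] G.
  apply: (@measurable_fun_fubini_tonelli_F _ _ _ _ R (lebesgue_cV R n) (f \o @cV_cons R
      n)).
    by apply: measurableT_comp => //; exact: measurable_cV_cons.
  by move=> z; exact: f0.
have G0 x : (0 <= G x)%E by exact: integral_ge0.
transitivity (`|a|%:E * \int[@lebesgue_measure R]_t G (a * t + 0)%R)%E; last first.
  by rewrite ge0_integral_affine// muleA -EFinM divff ?normr_eq0// mul1e.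
rewrite (@det_lblock R 1 n) det_scalar1 normrM EFinM -muleA; congr (_ * _)%E.
rewrite -ge0_integralZl//; last 2 first.
- apply: (@measurable_fun_fubini_tonelli_F _ _ _ _ R _ 
   (fun z => f ((block_mx a%:M 0 c D : 'M[R]_n.+1) *m cV_cons z))).
  apply: (measurableT_comp mf).
  apply: (measurableT_comp (measurable_mulmx _)).
  exact: measurable_cV_cons.
  by move=> z; exact: f0.
- by move=> t _; exact: integral_ge0.
apply: eq_integral => t _.
have mg : measurable_fun [set: 'cV[R]_n] (fun x => f (cV_cons (a * t, x))).
  by apply: (measurableT_comp mf); exact: measurable_cV_cons2.
rewrite addr0 /G -(@ge0_integral_translate _ _ (t *: c) (fun x => f (cV_cons (a * t,
    x))))//.
rewrite -(cD (fun x => f (cV_cons (a * t, t *: c + x))))//; last first.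
  by apply: (measurableT_comp mg); exact: measurable_addcV.
congr (_ * _)%E; apply: eq_integral => x _.
by rewrite mulmx_cV_cons/= mul0mx mxE addr0.
Qed.

(** Induction on the dimension. Once the corner entry is nonzero, B is a lower times an upper block
    triangular matrix, and the Schur complement in the latter is invertible because its determinant
    divides that of B. *)
Lemma linear_change_unit (R : realType) n (B : 'M[R]_n) :
  B \in unitmx -> linear_change B.
Proof.
elim: n B => [|n IH] B uB.
  by rewrite (flatmx0 B) -(flatmx0 1%:M); exact: linear_change1.
(* If B_00 = 0, add to the first row a row with a nonzero entry in column 0. *)
wlog a0 : B uB / B ord0 ord0 != 0.
  move=> H; have [a0|/H] := eqVneq (B ord0 ord0) 0; last exact.
  have [j cj] : exists j : 'I_n, B (lift ord0 j) ord0 != 0.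
    apply: contrapT => /forallNP c0; move: uB; apply/negP.
    rewrite unitmxE (expand_det_col B ord0) big1 ?unitr0//.
    move=> i _; have [k ->|->] := unliftP ord0 i; last by rewrite a0 mul0r.
    by have /negP/negPn/eqP -> := c0 k; rewrite mul0r.
  (* [E (-1)] inverts [E 1] and is itself upper block triangular, so B = E(-1) (E(1) B) reduces the
     claim to E(1) B. *)
  pose E (t : R) : 'M[R]_n.+1 := block_mx 1%:M (t *: (delta_mx ord0 j : 'rV[R]_n)) 0 1%:M.
  have uE t : E t \in unitmx by rewrite unitmxE (@det_ublock R 1 n) !det1 mulr1 unitr1.
  have EE : E (-1) *m E 1 = 1%:M.
    rewrite /E (@mulmx_block _ 1 n 1 n 1 n) !mulmx0 !mul0mx !mulmx1 !mul1mx !addr0 ?add0r.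
    by rewrite scaleN1r scale1r subrr -scalar_mx_block.
  rewrite -[B]mul1mx -EE -mulmxA; apply: linear_changeM.
    by apply: linear_change_ublock; [exact: oner_neq0|exact: linear_change1].
  apply: H; first by rewrite unitmx_mul uE.
  have -> : (E 1 *m B) ord0 ord0 = B ord0 ord0 + B (lift ord0 j) ord0.
    have l0 : (ord0 : 'I_n.+1) = lshift n (@ord0 0) by exact: val_inj.
    have lS i : lift ord0 i = rshift 1 i :> 'I_n.+1 by exact: val_inj.
    rewrite mxE big_ord_recl [in E 1 ord0 ord0]l0 (@block_mxEul _ 1 n 1 n) mxE mul1r;
        congr (_ + _).
    rewrite (bigD1 j)//= big1 ?addr0 => [|i ij].
      by rewrite {1}l0 {1}lS (@block_mxEur _ 1 n 1 n) !mxE !eqxx !mul1r.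
    by rewrite {1}l0 {1}lS (@block_mxEur _ 1 n 1 n) !mxE (negPf ij) andbF mulr0 mul0r.
  by rewrite a0 add0r.
pose a := B ord0 ord0; pose b := @ursubmx _ 1 n 1 n B.
pose c := @dlsubmx _ 1 n 1 n B; pose d := @drsubmx _ 1 n 1 n B.
(* Schur complement of the entry a. *)
have EB : B = (block_mx 1%:M 0 (a^-1 *: c) 1%:M : 'M[R]_n.+1) *m
    (block_mx a%:M b 0 (d - a^-1 *: (c *m b))).
  rewrite (@mulmx_block _ 1 n 1 n 1 n) !mulmx0 !mul0mx !mul1mx !addr0.
  rewrite -!scalemxAl [_ + (d - _)]addrC subrK mul_mx_scalar scalerA mulVf// scale1r.
  rewrite -[LHS](@submxK _ 1 n 1 n); have -> : @ulsubmx _ 1 n 1 n B = a%:M; last by [].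
  by apply/matrixP => i j; rewrite !ord1 !mxE/=; congr (B _ _); exact: val_inj.
have uD : d - a^-1 *: (c *m b) \in unitmx.
  move: uB; rewrite EB unitmx_mul => /andP[_].
  by rewrite !unitmxE (@det_ublock R 1 n) unitrM => /andP[].
rewrite EB; apply: linear_changeM.
  by apply: linear_change_lblock; [exact: oner_neq0|exact: linear_change1].
by apply: linear_change_ublock => //; exact: IH.
Qed.

(** * Open sets and bounded sets *)

Lemma le_mx_norm_entry (R : realType) n (x : 'cV[R]_n) i : `|x i ord0| <= `|x|.
Proof.
rewrite [leRHS]mx_normrE.
exact: (le_bigmax _ (fun ij : 'I_n * 'I_1 => `|x ij.1 ij.2|) (i, ord0)).
Qed.

(** The sigma-algebra is generated by coordinates, so boxes are measurable, and an open set is the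
    union of the countably many rational boxes that it contains. *)
Lemma open_measurable_cV (R : realType) n (U : set 'cV[R]_n) :
  open U -> measurable U.
Proof.
move=> oU.
pose box (z : 'cV[rat]_n * nat) : set 'cV[R]_n :=
  [set x | forall i, `|x i ord0 - ratr (z.1 i ord0)| < z.2.+1%:R^-1].
have mbox z : measurable (box z).
  pose J i : interval R :=
    `]ratr (z.1 i ord0) - z.2.+1%:R^-1, ratr (z.1 i ord0) + z.2.+1%:R^-1[.
  have -> : box z = \bigcap_(i in [set: 'I_n])
      ((fun x : 'cV[R]_n => x i ord0) @^-1` [set` J i]).
    apply/seteqP; split => [x bx i _ /=|x bx i].
      by rewrite in_itv/= -ltr_distl; exact: bx.
    by rewrite ltr_distl; have := bx i I; rewrite /= in_itv.
  apply: fin_bigcap_measurable => // i _.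
  by rewrite -[X in measurable X]setTI; apply: measurable_coor.
rewrite (_ : U = \bigcup_(z in [set: 'cV[rat]_n * nat]) (if pselect (box z `<=` U) then
    box z else set0)).
  by apply: countable_bigcupT_measurable => // z; case: ifP.
apply/seteqP; split => [x Ux|x [z _]]; last by case: pselect => // zU; exact: zU.
have /nbhs_ballP[e /= e0 eU] : nbhs x U by exact: open_nbhs_nbhs.
(* Twice the radius, since the box is centred at a rational point near x: its points are reached
   from x through that centre. *)
have [k ke] : exists k : nat, (2 * k.+1%:R^-1 < e :> R).
  have e20 : 0 < e / 2 by rewrite divr_gt0.
  have [k _ /(_ k (leqnn k)) ke] := near_infty_natSinv_lt (PosNum e20).
  by exists k; move: ke => /=; rewrite ltr_pdivlMr// mulrC.
have /choice[q qx] : forall i : 'I_n, exists q : rat, `|x i ord0 - ratr q| < k.+1%:R^-1.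
  move=> i.
  have [|q] := @rat_in_itvoo R (x i ord0 - k.+1%:R^-1) (x i ord0 + k.+1%:R^-1).
    by rewrite ltrD2l gtrN// invr_gt0.
  by rewrite in_itv/= => /andP[q1 q2]; exists q; rewrite ltr_distl ltrBlDr q2 -ltrBlDr.
exists (\col_i q i, k) => //.
have zU : box (\col_i q i, k) `<=` U.
  move=> y by_; apply: eU; split => // i j; rewrite ord1 /ball/=.
  apply: le_lt_trans ke; rewrite mulr_natl mulr2n.
  have := qx i; have := by_ i; rewrite /= mxE => h1 h2.
  rewrite (le_trans (ler_distD (ratr (q i)) _ _))// lerD// ltW// distrC//.
by case: pselect => // _ i; rewrite /= mxE.
Qed.

Lemma continuous_measurable_cV (R : realType) n (f : 'cV[R]_n -> R) :
  continuous f -> measurable_fun [set: 'cV[R]_n] f.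
Proof.
move=> /continuousP cf; apply: (measurability _ (RGenOpens.measurableE R)).
move=> _ [_ [a [b ->] <-]]; rewrite setTI; apply: open_measurable_cV.
by apply: cf; exact: interval_open.
Qed.

Lemma measurable_box (R : realType) n (M : R) :
  measurable [set x : 'cV[R]_n | forall i, x i ord0 \in `[- M, M]%R].
Proof.
rewrite (_ : [set x | _] = \bigcap_(i in [set: 'I_n])
    ((fun x : 'cV[R]_n => x i ord0) @^-1` `[- M, M]%classic)).
  apply: fin_bigcap_measurable => // i _.
  by rewrite -[X in measurable X]setTI; apply: measurable_coor.
by apply/seteqP; split => [x h i _|x h i]; [exact: h|exact: (h i I)].
Qed.

Lemma lebesgue_cV_box_fin (R : realType) n (M : R) :
  (lebesgue_cV R n [set x : 'cV[R]_n | forall i, x i ord0 \in `[- M, M]%R] < +oo)%E.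
Proof.
elim: n => [|n IH]; first by rewrite /= diracE; case: (_ \in _); rewrite ltry.
set A : set 'cV[R]_n.+1 := [set x : 'cV[R]_n.+1 | _].
have EA : @cV_cons R n @^-1` A =
    `[- M, M]%classic `*` [set x : 'cV[R]_n | forall i, x i ord0 \in `[- M, M]%R].
  apply/seteqP; split => [[a x] /= h|[a x] /= [ha hx] i].
    split; first by have := h ord0; rewrite cV_cons0.
    by move=> i; have := h (lift ord0 i); rewrite cV_consS.
  by have [j ->|->] := unliftP ord0 i; rewrite ?cV_consS ?cV_cons0.
change ((@lebesgue_measure R \x lebesgue_cV R n)%E (@cV_cons R n @^-1` A) < +oo)%E.
rewrite EA product_measure1E//; last exact: measurable_box.
have I_fin : (lebesgue_measure ([set` `[- M, M]%R]%classic : set R) < +oo)%E.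
  by rewrite lebesgue_measure_itv/=; case: ifPn => // _; rewrite -EFinD ltry.
by apply: lte_mul_pinfty => //; rewrite ge0_fin_numE.
Qed.

Lemma bounded_lebesgue_cV_fin (R : realType) n (O : set 'cV[R]_n) :
  bounded_set O -> measurable O -> (lebesgue_cV R n O < +oo)%E.
Proof.
move=> [M [_ /(_ (M + 1)) OM]] mO.
apply: le_lt_trans (lebesgue_cV_box_fin n (M + 1)).
apply: le_measure; rewrite ?inE//; first exact: measurable_box.
move=> x Ox i /=; rewrite in_itv/= -ler_norml.
by rewrite (le_trans (le_mx_norm_entry _ _))// OM ?ltrDl.
Qed.

(** * Affine change of variables, Euclidean and operator norms *)

Lemma affineK (R : realType) n (x0 : 'cV[R]_n) (B : 'M[R]_n) : B \in unitmx ->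
  cancel (affine x0 B) (affine (- (invmx B *m x0)) (invmx B)).
Proof. by move=> uB x; rewrite /affine mulmxDr mulKmx// addKr. Qed.

Lemma affineVK (R : realType) n (x0 : 'cV[R]_n) (B : 'M[R]_n) : B \in unitmx ->
  cancel (affine (- (invmx B *m x0)) (invmx B)) (affine x0 B).
Proof. by move=> uB x; rewrite /affine mulmxDr mulmxN !mulKVmx// addNKr. Qed.

Lemma measurable_affine (R : realType) n (x0 : 'cV[R]_n) (B : 'M[R]_n) :
  measurable_fun [set: 'cV[R]_n] (affine x0 B).
Proof.
exact: measurableT_comp (measurable_addcV x0) (measurable_mulmx B).
Qed.

Lemma measurable_affine_preimage (R : realType) n (x0 : 'cV[R]_n) (B : 'M[R]_n)
    (O : set 'cV[R]_n) : measurable O -> measurable (affine x0 B @^-1` O).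
Proof.
move=> mO; rewrite -[X in measurable X]setTI; exact: measurable_affine.
Qed.

Lemma measurable_comp_affine (R : realType) n (x0 : 'cV[R]_n) (B : 'M[R]_n)
    (O : set 'cV[R]_n) d (T : measurableType d) (f : 'cV[R]_n -> T) :
  measurable O -> measurable_fun O f ->
  measurable_fun (affine x0 B @^-1` O) (f \o affine x0 B).
Proof.
move=> mO mf; apply: (measurable_comp mO) => //; first by move=> _ [x Ox <-].
by apply: measurable_funS (@measurable_affine _ _ x0 B).
Qed.

Section affine_change_of_variables.
Context (R : realType) (n : nat) (x0 : 'cV[R]_n) (B : 'M[R]_n).
Hypothesis uB : B \in unitmx.
Local Notation F := (affine x0 B).
Local Notation mu := (lebesgue_cV R n).

Let detB0 : \det B != 0. Proof. by rewrite -unitfE -unitmxE. Qed.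

Lemma ge0_integral_affine_cV (D : set 'cV[R]_n) (f : 'cV[R]_n -> \bar R) :
  measurable D -> measurable_fun D f -> (forall x, D x -> 0 <= f x)%E ->
  (\int[mu]_(x in F @^-1` D) f (F x) = `|\det B|^-1%:E * \int[mu]_(x in D) f x)%E.
Proof.
move=> mD mf f0; rewrite (integral_mkcond D) (integral_mkcond (F @^-1` D)).
have mg : measurable_fun [set: 'cV[R]_n] (f \_ D) by exact/(measurable_restrictT _ _).1.
have g0 x : (0 <= (f \_ D) x)%E by exact: erestrict_ge0.
rewrite -(ge0_integral_translate x0 mg g0).
rewrite -(linear_change_unit uB (f := fun x => (f \_ D) (x0 + x)))//; last first.
  by apply: measurableT_comp => //; exact: measurable_addcV.
rewrite muleA -EFinM mulVf ?normr_eq0// mul1e.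
by apply: eq_integral => x _.
Qed.

Lemma lebesgue_cV_affine_preimage (A : set 'cV[R]_n) : measurable A ->
  mu (F @^-1` A) = (`|\det B|^-1%:E * mu A)%E.
Proof.
move=> mA; have := @ge0_integral_affine_cV A (cst 1%E) mA.
by rewrite !integral_cst//= ?mul1e; [apply|exact: measurable_affine_preimage].
Qed.

(** Applied to the positive and negative parts separately; integrability makes both integrals
    finite, so that [fine] commutes with their difference. *)
Lemma Rintegral_affine_cV (D : set 'cV[R]_n) (f : 'cV[R]_n -> R) :
  measurable D -> mu.-integrable D (EFin \o f) ->
  \int[mu]_(x in F @^-1` D) f (F x) = `|\det B|^-1 * \int[mu]_(x in D) f x.
Proof.
move=> mD fi; rewrite /Rintegral.
have mf : measurable_fun D (EFin \o f) by case/integrableP : fi.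
have /fineK Pf := integrable_pos_fin_num mD fi.
have /fineK Nf := integrable_neg_fin_num mD fi.
have hP := ge0_integral_affine_cV mD (measurable_funepos mf)
  (fun x _ => funepos_ge0 (EFin \o f) x).
have hN := ge0_integral_affine_cV mD (measurable_funeneg mf)
  (fun x _ => funeneg_ge0 (EFin \o f) x).
transitivity (fine (`|\det B|^-1%:E * \int[mu]_(x in D) (EFin \o f)^\+ x -
    `|\det B|^-1%:E * \int[mu]_(x in D) (EFin \o f)^\- x)%E).
  rewrite -hP -hN; congr fine; rewrite integralE; congr (_ - _)%E;
    by apply: eq_integral => x _; rewrite ?funeposE ?funenegE.
by rewrite (integralE _ D) -Pf -Nf/= mulrBr.
Qed.

Lemma ae_affine_cV (P : 'cV[R]_n -> Prop) :
  {ae mu, forall x, P x} -> {ae mu, forall x, P (F x)}.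
Proof.
move=> [N [mN N0 PN]]; exists (F @^-1` N); split.
- exact: measurable_affine_preimage.
- by rewrite lebesgue_cV_affine_preimage// N0 mule0.
- by move=> x Px; exact: PN.
Qed.

End affine_change_of_variables.

Section euclidean_norm.
Context {R : realType} {n : nat}.
Implicit Types (x y : 'cV[R]_n) (B : 'M[R]_n).

Lemma dotcv_ge0 x : 0 <= dotcv x x.
Proof. by apply: sumr_ge0 => i _; rewrite -expr2 sqr_ge0. Qed.

Lemma enorm_ge0 x : 0 <= enorm x. Proof. exact: sqrtr_ge0. Qed.

Lemma sqr_enorm x : enorm x ^+ 2 = dotcv x x.
Proof. by rewrite sqr_sqrtr// dotcv_ge0. Qed.

Lemma enorm0 : enorm (0 : 'cV[R]_n) = 0.
Proof. by rewrite /enorm /dotcv big1 ?sqrtr0// => i _; rewrite mxE mul0r. Qed.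

Lemma enorm_eq0 x : enorm x = 0 -> x = 0.
Proof.
move=> x0; have /eqP : dotcv x x = 0 by rewrite -sqr_enorm x0 expr0n.
rewrite /dotcv psumr_eq0 => [/allP h|i _]; last by rewrite -expr2 sqr_ge0.
apply/colP => i; rewrite mxE; apply/eqP.
by have := h i (mem_index_enum _); rewrite -expr2 sqrf_eq0.
Qed.

Lemma enormZ (a : R) x : enorm (a *: x) = `|a| * enorm x.
Proof.
rewrite /enorm -sqrtr_sqr -sqrtrM ?sqr_ge0//; congr Num.sqrt.
by rewrite mulr_sumr; apply: eq_bigr => i _; rewrite !mxE expr2; ring.
Qed.

Lemma le_enorm_entry x i : `|x i ord0| <= enorm x.
Proof.
rewrite -sqrtr_sqr ler_sqrt ?dotcv_ge0// /dotcv (bigD1 i)//= expr2 lerDl.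
by apply: sumr_ge0 => j _; rewrite -expr2 sqr_ge0.
Qed.

Lemma dotcv_enorm x y : dotcv x y <= enorm x * enorm y.
Proof.
have [x0|x0] := eqVneq (enorm x) 0.
  by rewrite x0 mul0r (enorm_eq0 x0) /dotcv big1// => i _; rewrite mxE mul0r.
have [y0|y0] := eqVneq (enorm y) 0.
  by rewrite y0 mulr0 (enorm_eq0 y0) /dotcv big1// => i _; rewrite mxE mulr0.
have a0 : 0 < enorm x by rewrite lt_def x0 enorm_ge0.
have b0 : 0 < enorm y by rewrite lt_def y0 enorm_ge0.
set a := enorm x in a0 *; set b := enorm y in b0 *.
(* 0 <= |b x - a y|^2 with a = |x| and b = |y|. *)
have : 0 <= \sum_(i < n) (b * x i ord0 - a * y i ord0) ^+ 2.
  by apply: sumr_ge0 => i _; rewrite sqr_ge0.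
have -> : \sum_(i < n) (b * x i ord0 - a * y i ord0) ^+ 2 =
    b ^+ 2 * dotcv x x - (a * b) * dotcv x y *+ 2 + a ^+ 2 * dotcv y y.
  rewrite /dotcv -mulrnAl !mulr_sumr -sumrB -big_split/=; apply: eq_bigr => i _.
  by ring.
rewrite -!sqr_enorm -/a -/b => h.
have : 0 < a * b by exact: mulr_gt0.
nra.
Qed.

(** [sup] has a default value on unbounded sets, so [opnorm] is meaningful only with this bound. The
    entries of x are at most 1 in absolute value, hence those of B x are bounded by the absolute row
    sums. *)
Lemma opnorm_has_sup B : has_sup [set enorm (B *m x) | x in [set x | enorm x <= 1]].
Proof.
split; first by exists (enorm (B *m 0)), 0 => //=; rewrite enorm0.
pose M := \sum_(i < n) (\sum_(j < n) `|B i j|) ^+ 2.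
have M0 : 0 <= M by apply: sumr_ge0 => i _; rewrite sqr_ge0.
exists (Num.sqrt M) => _ [x /= x1 <-]; rewrite ler_sqrt//.
apply: ler_sum => i _; rewrite -expr2 -real_normK ?num_real// lerXn2r ?nnegrE//.
  by apply: sumr_ge0.
rewrite mxE (le_trans (ler_norm_sum _ _ _))//; apply: ler_sum => j _.
by rewrite normrM ler_piMr// (le_trans (le_enorm_entry _ _)).
Qed.

Lemma opnorm_ge0 B : 0 <= opnorm B.
Proof.
apply: (le_trans (enorm_ge0 (B *m 0))); apply: ub_le_sup.
  by case: (opnorm_has_sup B).
by exists 0 => //=; rewrite enorm0.
Qed.

Lemma enorm_mulmx B x : enorm (B *m x) <= opnorm B * enorm x.
Proof.
have [x0|x0] := eqVneq (enorm x) 0.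
  by rewrite x0 mulr0 (enorm_eq0 x0) mulmx0 enorm0.
have a0 : 0 < enorm x by rewrite lt_def x0 enorm_ge0.
rewrite -ler_pdivrMr//.
have -> : enorm (B *m x) / enorm x = enorm (B *m ((enorm x)^-1 *: x)).
  by rewrite -scalemxAr enormZ ger0_norm ?invr_ge0 ?enorm_ge0// mulrC.
apply: ub_le_sup; first by case: (opnorm_has_sup B).
exists ((enorm x)^-1 *: x) => //=.
by rewrite enormZ ger0_norm ?invr_ge0 ?enorm_ge0// mulVf.
Qed.

Lemma dotcv_mulmx B x y : dotcv x (B *m y) = dotcv (B^T *m x) y.
Proof.
rewrite /dotcv; under eq_bigr do rewrite mxE mulr_sumr.
rewrite exchange_big/=; apply: eq_bigr => j _; rewrite mxE mulr_suml.
by apply: eq_bigr => i _; rewrite mxE; ring.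
Qed.

(** With y = B^T x one has |y|^2 = x . (B y) <= |x| ||B|| |y|. Gradients of pullbacks carry B^T,
    whereas the constants of the theorem involve ||B||. *)
Lemma enorm_trmx B x : enorm (B^T *m x) <= opnorm B * enorm x.
Proof.
have [y0|y0] := eqVneq (enorm (B^T *m x)) 0.
  by rewrite y0 mulr_ge0 ?opnorm_ge0 ?enorm_ge0.
have b0 : 0 < enorm (B^T *m x) by rewrite lt_def y0 enorm_ge0.
rewrite -(ler_pM2r b0) -expr2 sqr_enorm -dotcv_mulmx.
rewrite (le_trans (dotcv_enorm _ _))// [opnorm _ * _]mulrC -mulrA.
by rewrite ler_wpM2l ?enorm_ge0// enorm_mulmx.
Qed.

(** In dimension 0 the empty matrix is invertible and has norm 0, whence [0 < n]. *)
Lemma opnorm_gt0 B : (0 < n)%N -> B \in unitmx -> 0 < opnorm B.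
Proof.
move=> n0 uB; rewrite lt_def opnorm_ge0 andbT; apply/eqP => B0.
pose i0 := Ordinal n0; pose x : 'cV[R]_n := delta_mx i0 ord0.
have : B *m x = 0.
  apply: enorm_eq0; apply/eqP; rewrite eq_le enorm_ge0 andbT.
  by rewrite (le_trans (enorm_mulmx _ _))// B0 mul0r.
move=> /(congr1 (mulmx (invmx B))); rewrite mulKmx// mulmx0 => /matrixP/(_ i0 ord0).
by rewrite !mxE !eqxx => /eqP; rewrite oner_eq0.
Qed.

End euclidean_norm.

(** * Test functions *)

Section affine_smooth.
Context {R : realType} {n : nat}.
Implicit Types (O : set 'cV[R]_n) (B : 'M[R]_n) (f phi : 'cV[R]_n -> R).

Lemma differentiable_affine (x0 : 'cV[R]_n) B x : differentiable (affine x0 B) x.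
Proof.
have -> : affine x0 B = cst x0 + \sum_(j < n) (fun x : 'cV[R]_n => (x j ord0 : R) *:
    col j B).
  apply/funext => y; rewrite fct_sumE; congr (x0 + _); apply/colP => i.
  by rewrite summxE mxE; apply: eq_bigr => j _; rewrite !mxE mulrC.
apply: differentiableD => //; apply: differentiable_sum => j.
exact/differentiableZl/differentiable_coord.
Qed.

Lemma continuous_affine (x0 : 'cV[R]_n) B : continuous (affine x0 B).
Proof. by move=> x; exact: differentiable_continuous (differentiable_affine x0 B x). Qed.

(** The two difference quotients are the same function of h, so this chain rule holds for arbitrary
    [f]. *)
Lemma derive_comp_affine (x0 : 'cV[R]_n) B f u x :
  'D_u (f \o affine x0 B) x = 'D_(B *m u) f (affine x0 B x).
Proof.
rewrite /derive; set g := (fun h => _); set g' := (fun h => _).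
suff -> : g = g' by [].
by apply/funext => h; rewrite /g /g' /= /affine mulmxDr -scalemxAr addrCA.
Qed.

Lemma differentiable_upto_comp_affine (x0 : 'cV[R]_n) B m f :
  differentiable_upto m f -> differentiable_upto m (f \o affine x0 B).
Proof.
elim: m f => [|m IH] f /=.
  move=> cf x; apply: continuous_comp; last exact: cf.
  exact: continuous_affine.
move=> [df Df]; split => [x|u].
  by apply: differentiable_comp; [exact: differentiable_affine|exact: df].
rewrite (_ : (fun x => _) = (fun y => 'D_(B *m u) f y) \o affine x0 B).
  exact: IH.
by apply/funext => x; rewrite derive_comp_affine.
Qed.

Lemma test_function_comp_affine O (x0 : 'cV[R]_n) B phi :
  B \in unitmx -> test_function O phi ->
  test_function (affine x0 B @^-1` O) (phi \o affine x0 B).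
Proof.
move=> uB [sphi cphi phiO].
set F := affine x0 B; set G := affine (- (invmx B *m x0)) (invmx B).
(* An inclusion is enough: the right side is compact as the image of the old support under [G], and
   compactness passes to closed subsets. *)
have sub : closure [set x | (phi \o F) x != 0] `<=` F @^-1` closure [set x | phi x != 0].
  have cl : closed (F @^-1` closure [set x | phi x != 0]).
    apply: preimage_closed; last exact: closed_closure.
    by move=> x _; exact: continuous_affine.
  rewrite [X in _ `<=` X](closure_id _).1//; apply: closureS => x /= Fx0.
  exact: subset_closure.
split.
- by move=> m; apply: differentiable_upto_comp_affine.
- apply: subclosed_compact sub; first exact: closed_closure.
  rewrite (_ : F @^-1` _ = G @` closure [set x | phi x != 0]).
    apply: continuous_compact => //; apply: continuous_subspaceT => x.
    exact: continuous_affine.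
  apply/seteqP; split => [x /= Fx|_ [x xS <-]].
    by exists (F x) => //; rewrite /G /F affineK.
  by rewrite /preimage/= /G /F affineVK.
- by move=> x /sub /phiO.
Qed.

End affine_smooth.

(** * Integrals of derivatives of test functions *)

Section compact_support.
Context {R : realType} {n : nat}.
Local Notation mu := (lebesgue_cV R n).
Implicit Types (O K : set 'cV[R]_n) (f phi : 'cV[R]_n -> R) (u x : 'cV[R]_n) (M h : R).

Lemma compact_support_bounded K f : compact K -> continuous f ->
  (forall x, f x != 0 -> K x) -> exists M : R, forall x, `|f x| <= M.
Proof.
move=> cK cf fK.
have [M [_ /(_ (`|M| + 1)) fM]] : bounded_set (f @` K).
  by apply: compact_bounded; apply: continuous_compact => //; exact: continuous_subspaceT.
exists (`|M| + 1) => x; have [->|/fK Kx] := eqVneq (f x) 0.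
  by rewrite normr0 addr_ge0.
by apply: fM; [rewrite (le_lt_trans (ler_norm _))// ltrDl|exists x].
Qed.

(** Off the closed support [phi] vanishes on a neighbourhood and can be replaced there by the
    constant 0. *)
Lemma derive_support phi u x :
  'D_u phi x != 0 -> closure [set y | phi y != 0] x.
Proof.
apply: contra_neqP => Nx.
rewrite (@near_eq_derive _ _ _ phi (cst 0)) ?derive_cst//.
have : nbhs x (~` closure [set y | phi y != 0]).
  by apply: open_nbhs_nbhs; split => //; exact/closed_openC/closed_closure.
apply: filterS => y Ny.
by apply/eqP/negPn/negP => py; apply: Ny; exact: subset_closure.
Qed.

Lemma continuous_derive O phi u : test_function O phi -> continuous ('D_u phi).
Proof. by move=> [/(_ 1%N)[_ /(_ u)]]. Qed.

Lemma test_function_continuous O phi : test_function O phi -> continuous phi.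
Proof. by move=> [/(_ 0%N)]. Qed.

Lemma test_function_differentiable O phi x : test_function O phi -> differentiable phi x.
Proof. by move=> [/(_ 1%N)[/(_ x)]]. Qed.

Lemma bounded_integrable O f M : measurable O -> (mu O < +oo)%E ->
  measurable_fun O f -> (forall x, `|f x| <= M) -> mu.-integrable O (EFin \o f).
Proof.
move=> mO Ofin mf fM; apply: measurable_bounded_integrable => //.
exists M; split; first exact: num_real.
by move=> x Mx y _; exact: le_trans (fM y) (ltW Mx).
Qed.

Lemma difference_quotient_le O phi u M x h :
  test_function O phi -> (forall y, `|'D_u phi y| <= M) -> 0 < h ->
  `|h^-1 * (phi (h *: u + x) - phi x)| <= M.
Proof.
move=> tphi phiM h0.
pose p (t : R) : R := phi (t *: u + x).
have dp (t : R) : is_derive t (1 : R) p ('D_u phi (t *: u + x)).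
  (* The difference quotients of [p] at [t] are those of [phi] at [t *: u + x] in direction [u], so
     derivability and the value of the derivative transfer together. *)
  have E : (fun r : R => r^-1 *: ((p \o shift t) (r *: 1) - p t)) =
      (fun r : R => r^-1 *: ((phi \o shift (t *: u + x)) (r *: u) - phi (t *: u + x))).
    by apply/funext => r; rewrite /p /= [_ *: 1]mulr1 scalerDl addrA.
  have dphi : derivable phi (t *: u + x) u.
    by apply: diff_derivable; exact: test_function_differentiable tphi.
  by apply: DeriveDef; [rewrite /derivable E|rewrite /derive E].
have cp : {within `[0, h], continuous p}.
  by apply: derivable_within_continuous => t _; have [] := dp t.
have [t _] := MVT_segment (ltW h0) (fun t _ => dp t) cp.
rewrite /p scale0r add0r subr0 => ->.
by rewrite mulrCA mulVf ?gt_eqF// mulr1.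
Qed.

(* By translation invariance the difference quotients of phi have integral 0;
   the mean value theorem dominates them. *)
Lemma integral_derive_eq0 O phi u : measurable O -> test_function O phi ->
  \int[mu]_(x in O) 'D_u phi x = 0.
Proof.
move=> mO tphi; have [_ csupp suppO] := tphi.
set S := closure _ in csupp suppO.
have phiS x : phi x != 0 -> S x by move=> ?; exact: subset_closure.
have [M phiM] := compact_support_bounded csupp (test_function_continuous tphi) phiS.
have [M1 DM] := compact_support_bounded csupp (@continuous_derive _ _ u tphi)
    (@derive_support phi u).
have [m [_ /(_ (`|m| + 1)) Sm]] := compact_bounded csupp.
have {}Sm x : S x -> `|x| <= `|m| + 1.
  by apply: Sm; rewrite (le_lt_trans (ler_norm _))// ltrDl.
(* The margin [|u|] accounts for the shift by [h k *: u] with [h k <= 1]: outside [Bx] both [phi]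
   and its translate vanish. *)
pose r := `|m| + 1 + `|u|.
pose Bx : set 'cV[R]_n := [set x : 'cV[R]_n | forall i, x i ord0 \in `[- r, r]%R].
have mBx : measurable Bx by exact: measurable_box.
pose h k : R := k.+1%:R^-1.
have h0 k : 0 < h k by rewrite invr_gt0.
have h1 k : h k <= 1 by rewrite invf_le1 ?ler1n.
pose g k x := (h k)^-1 * (phi (h k *: u + x) - phi x).
have mphi : measurable_fun [set: 'cV[R]_n] phi.
  exact: continuous_measurable_cV (test_function_continuous tphi).
have mphih k : measurable_fun [set: 'cV[R]_n] (fun x => phi (h k *: u + x)).
  by apply: (measurableT_comp mphi); exact: measurable_addcV.
have mg k : measurable_fun [set: 'cV[R]_n] (g k).
  by apply: measurable_funM => //; exact: measurable_funB.
have ge0M1 : 0 <= M1 by exact: le_trans (DM 0).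
have inBx x k : x \notin Bx -> phi x = 0 /\ phi (h k *: u + x) = 0.
  rewrite notin_setE => xB; split; apply/eqP/negPn/negP => /phiS/Sm xm; apply: xB => i.
    rewrite in_itv/= -ler_norml (le_trans (le_mx_norm_entry _ _))// (le_trans xm)//.
    by rewrite lerDl.
  rewrite in_itv/= -ler_norml (le_trans (le_mx_norm_entry _ _))//.
  rewrite -[x](addKr (h k *: u)) addrC (le_trans (ler_normB _ _))// lerD//.
  by rewrite normrZ ler_piMl// gtr0_norm.
have zero_out (f : 'cV[R]_n -> R) : (forall x, x \notin Bx -> f x = 0) -> f \_ Bx = f.
  by move=> f0; apply/funext => x; rewrite /patch; case: ifPn => // /f0.
have Bfin : (mu Bx < +oo)%E by exact: lebesgue_cV_box_fin.
have iphi : mu.-integrable setT (EFin \o phi).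
  rewrite -(zero_out phi) => [|x xB]; last by have [] := inBx x 0%N xB.
  rewrite -restrict_EFin -integrable_mkcond//.
  by apply: bounded_integrable phiM => //; exact: measurable_funTS.
have iphih k : mu.-integrable Bx (EFin \o (fun x => phi (h k *: u + x))).
  by apply: (@bounded_integrable _ _ M) => //; exact: measurable_funTS.
have Ig k : \int[mu]_(x in Bx) g k x = 0.
  rewrite RintegralZl//; last first.
    apply: (@bounded_integrable _ _ (M + M)) => //.
      by apply: measurable_funTS; exact: measurable_funB.
    by move=> x; rewrite (le_trans (ler_normB _ _))// lerD.
  rewrite RintegralB//; last exact: integrableS iphi.
  rewrite (Rintegral_mkcond _ Bx) zero_out => [|x /(inBx x k)[]//].
  rewrite (Rintegral_mkcond _ Bx phi) zero_out => [|x /(inBx x k)[]//].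
  have := @Rintegral_affine_cV R n (h k *: u) 1%:M (unitmx1 _ _) setT phi measurableT
      iphi.
  rewrite det1 normr1 invr1 mul1r preimage_setT => <-.
  rewrite (_ : (fun x => phi (h k *: u + x)) = (fun x => phi (affine (h k *: u) 1%:M x))).
    by rewrite subrr mulr0.
  by apply/funext => x; rewrite /affine mul1mx.
have mD : measurable_fun [set: 'cV[R]_n] ('D_u phi).
  by apply: continuous_measurable_cV; exact: continuous_derive tphi.
have [] := @dominated_convergence _ _ R mu Bx mBx
  (fun k x => (g k x)%:E) (fun x => ('D_u phi x)%:E) (cst M1%:E).
- by move=> k; apply/measurable_EFinP; exact: measurable_funTS.
- by apply/measurable_EFinP; exact: measurable_funTS.
- apply: aeW => x _; apply/fine_cvgP; split; first exact: nearW.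
  have dphi : derivable phi x u.
    by apply: diff_derivable; exact: test_function_differentiable tphi.
  move/cvgr_dnbhsP : dphi => /(_ h); apply; split; last exact: cvg_harmonic.
  by move=> k; rewrite gt_eqF.
- by apply: (@bounded_integrable _ _ M1 mBx Bfin) => // x; rewrite ger0_norm.
- apply: aeW => x k _; rewrite lee_fin; exact: difference_quotient_le tphi DM _.
(* Each difference quotient integrates to 0 by [Ig], hence so does their dominated limit. *)
move=> _ _; rewrite (_ : (fun k => _) = cst 0%E); last first.
  apply/funext => k; rewrite -[LHS]fineK; first by rewrite [fine _]Ig.
  apply: integrable_fin_num => //.
  apply: (@bounded_integrable _ _ M1) => //; first exact: measurable_funTS.
  by move=> x; exact: difference_quotient_le tphi DM _.
move=> lim0; have E := cvg_unique (@ereal_hausdorff R) lim0 (cvg_cst 0%E).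
(* The derivative vanishes off the support of [phi], which lies in both [O] and [Bx], so the two
   domains give the same integral. *)
transitivity (\int[mu]_(x in Bx) 'D_u phi x); last by rewrite /Rintegral E.
rewrite (Rintegral_mkcond _ Bx) zero_out => [|x xB].
  rewrite Rintegral_mkcond; apply: eq_Rintegral => x _; rewrite /patch.
  case: ifPn => // /negP xO; apply/esym/eqP/negPn/negP => /derive_support/suppO.
  by move/mem_set.
apply/eqP/negPn/negP => /derive_support/Sm xm; move: xB; rewrite notin_setE; apply => i.
rewrite /= in_itv/= -ler_norml (le_trans (le_mx_norm_entry _ _))// (le_trans xm)//.
by rewrite lerDl.
Qed.
End compact_support.

(** * Pullbacks and translates in L^2 and H^1 *)

Section L2_theory.
Context {R : realType} {n : nat}.
Local Notation mu := (lebesgue_cV R n).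
Implicit Types (O : set 'cV[R]_n) (v w : 'cV[R]_n -> R).

Lemma sqr_l2norm O v : (l2norm O v ^+ 2 = \int[mu]_(x in O) ((v x) ^+ 2)%:E)%E.
Proof. by rewrite sqr_sqrte// integral_ge0// => x _; rewrite lee_fin sqr_ge0. Qed.

Lemma sqrte_lty (x : \bar R) : (sqrte x < +oo)%E = (x < +oo)%E.
Proof. by case: x => [r||] //; rewrite /= ?ltry. Qed.

Lemma L2P O v : L2 O v <->
  measurable_fun O v /\ (\int[mu]_(x in O) ((v x) ^+ 2)%:E < +oo)%E.
Proof. by rewrite /L2 /l2norm sqrte_lty. Qed.

Lemma sqr_sum_le (a b : R) : (a + b) ^+ 2 <= 2 * a ^+ 2 + 2 * b ^+ 2.
Proof. by have := sqr_ge0 (a - b); rewrite !expr2; nra. Qed.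

Lemma measurable_sqr O v : measurable_fun O v ->
  measurable_fun O (fun x => ((v x) ^+ 2)%:E).
Proof. by move=> mv; apply/measurable_EFinP; exact: measurable_funX. Qed.

Lemma L2Z O v (a : R) : measurable O -> L2 O v -> L2 O (fun x => a * v x).
Proof.
move=> mO /L2P[mv v2]; apply/L2P; split; first exact: measurable_funM.
under eq_integral do rewrite exprMn EFinM.
rewrite ge0_integralZl//; last by rewrite lee_fin sqr_ge0.
- by rewrite lte_mul_pinfty// lee_fin sqr_ge0.
- exact: measurable_sqr.
- by move=> x _; rewrite lee_fin sqr_ge0.
Qed.

Lemma L2D O v w : measurable O -> L2 O v -> L2 O w -> L2 O (fun x => v x + w x).
Proof.
move=> mO Lv Lw; have [mv _] := Lv; have [mw _] := Lw.
apply/L2P; split; first exact: measurable_funD.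
apply: (@le_lt_trans _ _ (\int[mu]_(x in O) ((2 * (v x ^+ 2))%:E + (2 * (w x ^+
    2))%:E))%E).
  apply: ge0_le_integral => //.
  - by move=> x _; rewrite lee_fin sqr_ge0.
  - by apply: measurable_sqr; exact: measurable_funD.
  - by apply: emeasurable_funD; apply/measurable_EFinP; apply: measurable_funM => //;
      exact: measurable_funX.
  - by move=> x _; rewrite -EFinD lee_fin sqr_sum_le.
have m2 (u : 'cV[R]_n -> R) : measurable_fun O u -> measurable_fun O (fun x => (2 * (u
    x ^+ 2))%:E).
  by move=> mu_; apply/measurable_EFinP; apply: measurable_funM => //; exact:
      measurable_funX.
rewrite ge0_integralD//; try (by move=> x _; rewrite lee_fin mulr_ge0 ?sqr_ge0); try
    exact: m2.
have f2 u : L2 O u -> (\int[mu]_(x in O) (2 * (u x ^+ 2))%:E < +oo)%E.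
  move=> /L2P[mu_ u2]; under eq_integral do rewrite EFinM.
  rewrite ge0_integralZl//; first by rewrite lte_mul_pinfty.
    exact: measurable_sqr.
  by move=> x _; rewrite lee_fin sqr_ge0.
by rewrite lte_add_pinfty ?f2.
Qed.

Lemma L2_cst O (a : R) : measurable O -> (mu O < +oo)%E -> L2 O (cst a).
Proof.
move=> mO Ofin; apply/L2P; split => //=.
by rewrite integral_cst// lte_mul_pinfty// lee_fin sqr_ge0.
Qed.

Lemma L2_sum O m (f : 'I_m -> 'cV[R]_n -> R) : measurable O -> (mu O < +oo)%E ->
  (forall j, L2 O (f j)) -> L2 O (fun x => \sum_(j < m) f j x).
Proof.
move=> mO Ofin; elim: m f => [|m IH] f Lf.
  by rewrite (_ : (fun x => _) = cst 0); [exact: L2_cst|apply/funext => x; rewrite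
      big_ord0].
rewrite (_ : (fun x => _) = (fun x => f ord0 x + \sum_(j < m) f (lift ord0 j) x)).
  by apply: L2D => //; exact: IH.
by apply/funext => x; rewrite big_ord_recl.
Qed.

(** |v| <= 1 + v^2, and the constant 1 is integrable on a set of finite measure. *)
Lemma L2_integrable O v : measurable O -> (mu O < +oo)%E -> L2 O v ->
  mu.-integrable O (EFin \o v).
Proof.
move=> mO Ofin /L2P[mv v2]; apply/integrableP; split; first exact/measurable_EFinP.
apply: (@le_lt_trans _ _ (\int[mu]_(x in O) (cst 1 x + ((v x) ^+ 2)%:E))%E).
  apply: ge0_le_integral => //.
  - by apply: measurableT_comp => //; exact/measurable_EFinP.
  - by apply: emeasurable_funD => //; exact: measurable_sqr.
  - move=> x _; rewrite /= -EFinD lee_fin -real_normK ?num_real//.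
    by have := sqr_ge0 (`|v x| - 1); rewrite !expr2; nra.
rewrite ge0_integralD//; last 2 first.
- by move=> x _; rewrite lee_fin sqr_ge0.
- exact: measurable_sqr.
by rewrite integral_cst// mul1e lte_add_pinfty.
Qed.

Lemma L2_integrableM O v (psi : 'cV[R]_n -> R) (M : R) :
  measurable O -> (mu O < +oo)%E -> L2 O v ->
  measurable_fun O psi -> (forall x, `|psi x| <= M) ->
  mu.-integrable O (EFin \o (fun x => v x * psi x)).
Proof.
move=> mO Ofin Lv mpsi psiM.
have M0 : 0 <= M by exact: le_trans (psiM 0).
have iv := L2_integrable mO Ofin Lv.
apply: (@le_integrable _ _ _ mu O mO _ (fun x => M%:E * (EFin \o v) x)%E).
- by apply/measurable_EFinP; apply: measurable_funM => //; case: Lv.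
- move=> x _ /=; rewrite lee_fin !normrM mulrC ler_wpM2r//.
  by rewrite [leRHS]ger0_norm.
- exact: integrableZl.
Qed.

Lemma Rintegral_sum O m (f : 'I_m -> 'cV[R]_n -> R) : measurable O ->
  (forall j, mu.-integrable O (EFin \o f j)) ->
  \int[mu]_(x in O) (\sum_(j < m) f j x) = \sum_(j < m) \int[mu]_(x in O) f j x.
Proof.
move=> mO; elim: m f => [|m IH] f fi.
  rewrite big_ord0; under eq_Rintegral do rewrite big_ord0.
  by rewrite Rintegral_cst// mul0r.
rewrite big_ord_recl -IH//; under eq_Rintegral do rewrite big_ord_recl.
rewrite RintegralD//.
rewrite (_ : EFin \o _ = (fun x => \sum_(j < m) (f (lift ord0 j) x)%:E)%E).
  by apply: integrable_sum => // j _; exact: fi.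
by apply/funext => x; rewrite /= sumEFin.
Qed.

Lemma L2_comp_affine O v (x0 : 'cV[R]_n) (B : 'M[R]_n) : B \in unitmx ->
  measurable O -> L2 O v -> L2 (affine x0 B @^-1` O) (v \o affine x0 B).
Proof.
move=> uB mO /L2P[mv v2]; apply/L2P; split; first exact: measurable_comp_affine.
rewrite (ge0_integral_affine_cV x0 uB (f := fun x => ((v x) ^+ 2)%:E))//.
- by rewrite lte_mul_pinfty// lee_fin invr_ge0.
- exact: measurable_sqr.
- by move=> x _; rewrite lee_fin sqr_ge0.
Qed.

Lemma sqr_l2norm_comp_affine O v (x0 : 'cV[R]_n) (B : 'M[R]_n) : B \in unitmx ->
  measurable O -> measurable_fun O v ->
  (l2norm (affine x0 B @^-1` O) (v \o affine x0 B) ^+ 2 =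
   `|\det B|^-1%:E * l2norm O v ^+ 2)%E.
Proof.
move=> uB mO mv; rewrite !sqr_l2norm.
rewrite (ge0_integral_affine_cV x0 uB (f := fun x => ((v x) ^+ 2)%:E))//.
- exact: measurable_sqr.
- by move=> x _; rewrite lee_fin sqr_ge0.
Qed.

End L2_theory.

(** * Adding constants and pulling back in H^1 *)

Section H1_constructions.
Context {R : realType} {n : nat} (O : set 'cV[R]_n).
Local Notation mu := (lebesgue_cV R n).
Hypotheses (mO : measurable O) (Ofin : (mu O < +oo)%E).

Lemma test_functionM_integrable v phi : L2 O v -> test_function O phi ->
  mu.-integrable O (EFin \o (fun x => v x * phi x)).
Proof.
move=> Lv tphi; have [_ cK _] := tphi.
have cphi := test_function_continuous tphi.
have [M phiM] := compact_support_bounded cK cphi (@subset_closure _ [set x | phi x != 0]).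
apply: L2_integrableM phiM => //; apply: measurable_funTS.
exact: continuous_measurable_cV.
Qed.

Lemma test_function_deriveM_integrable v phi u : L2 O v -> test_function O phi ->
  mu.-integrable O (EFin \o (fun x => v x * 'D_u phi x)).
Proof.
move=> Lv tphi; have [_ cK _] := tphi.
have cphi := @continuous_derive _ _ _ _ u tphi.
have [M phiM] := compact_support_bounded cK cphi (fun x h => derive_support h).
apply: L2_integrableM phiM => //; apply: measurable_funTS.
exact: continuous_measurable_cV.
Qed.

(** The extra term is c times the integral of a partial derivative of a test function, which is
    0. *)
Lemma weak_gradientDc v g (c : R) : L2 O v ->
  weak_gradient O v g -> weak_gradient O (fun x => v x + c) g.
Proof.
move=> Lv wg phi tphi i; rewrite -(wg phi tphi i).
under eq_Rintegral do rewrite mulrDl.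
have Lc := L2_cst c mO Ofin.
rewrite RintegralD//; [|exact: test_function_deriveM_integrable..].
have L1 := L2_cst 1 mO Ofin.
rewrite RintegralZl//; last first.
  have := test_function_deriveM_integrable (delta_mx i ord0) L1 tphi.
  by congr (mu.-integrable _ _); apply/funext => x /=; rewrite mul1r.
by rewrite [X in c * X](integral_derive_eq0 _ mO tphi) mulr0 addr0.
Qed.

(** The gradient field is that of [w] itself, so the H^1 seminorms of both are convertible. *)
Definition H1_addc (c : R) (w : H1 O) : H1 O :=
  MkH1 (L2D mO (H1_L2 w) (L2_cst c mO Ofin)) (H1_grad_L2 w)
    (weak_gradientDc c (H1_L2 w) (H1_weak_gradient w)).

(** A test function on the preimage is phi o F for the test function phi = phi' o F^-1 on O, and its
    i-th derivative is the sum over j of B_ji (d_j phi) o F. After a change of variables on both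
    sides the factor |det B|^-1 cancels, and the equation for [v] applies for each j. *)
Lemma weak_gradient_comp_affine (x0 : 'cV[R]_n) (B : 'M[R]_n) v (g : 'cV[R]_n ->
    'cV[R]_n) : B \in unitmx ->
  L2 O v -> (forall i, L2 O (fun x => g x i ord0)) ->
  weak_gradient O v g ->
  weak_gradient (affine x0 B @^-1` O) (v \o affine x0 B)
    (fun x => B^T *m g (affine x0 B x)).
Proof.
move=> uB Lv Lg wg phi' tphi' i.
pose phi := phi' \o affine (- (invmx B *m x0)) (invmx B).
have tphi : test_function O phi.
  have := @test_function_comp_affine _ _ _ (- (invmx B *m x0)) (invmx B) _ _ tphi'.
  rewrite unitmx_inv => /(_ uB); congr test_function.
  by apply/seteqP; split => x; rewrite /preimage/= affineVK.
have Ephi x : phi' x = phi (affine x0 B x) by rewrite /phi/= affineK.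
have Dphi x : partial i phi' x = \sum_(j < n) B j i * partial j phi (affine x0 B x).
  rewrite /partial (_ : phi' = phi \o affine x0 B); last exact/funext.
  rewrite derive_comp_affine deriveE; last exact: test_function_differentiable tphi.
  rewrite (_ : B *m delta_mx i ord0 = \sum_j B j i *: delta_mx j ord0); last first.
    rewrite -colE; apply/colP => k; rewrite mxE summxE (bigD1 k)//= big1 => [|j jk].
      by rewrite !mxE !eqxx mulr1 addr0.
    by rewrite !mxE eq_sym (negPf jk) mulr0.
  rewrite linear_sum; apply: eq_bigr => j _; rewrite linearZ/= -deriveE//.
  exact: test_function_differentiable tphi.
have mF := measurable_affine_preimage x0 B mO.
pose pv y := \sum_(j < n) B j i * (v y * partial j phi y).
pose pg y := \sum_(j < n) B j i * (g y j ord0 * phi y).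
transitivity (\int[mu]_(x in affine x0 B @^-1` O) pv (affine x0 B x)).
  apply: eq_Rintegral => x _; rewrite Dphi mulr_sumr; apply: eq_bigr => j _ /=.
  by rewrite mulrCA.
have int1 j : mu.-integrable O (EFin \o (fun y => B j i * (v y * partial j phi y))).
  rewrite (_ : _ \o _ = fun y => ((B j i)%:E * (v y * partial j phi y)%:E)%E)//.
  by apply: integrableZl => //; exact: test_function_deriveM_integrable.
have int2 j : mu.-integrable O (EFin \o (fun y => B j i * (g y j ord0 * phi y))).
  rewrite (_ : _ \o _ = fun y => ((B j i)%:E * (g y j ord0 * phi y)%:E)%E)//.
  by apply: integrableZl => //; exact: (@test_functionM_integrable (fun y => g y j ord0)).
have intS (f : 'I_n -> 'cV[R]_n -> R) : (forall j, mu.-integrable O (EFin \o f j)) ->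
    mu.-integrable O (EFin \o (fun y => \sum_(j < n) f j y)).
  move=> fi; rewrite (_ : EFin \o _ = (fun x => \sum_(j < n) (f j x)%:E)%E).
    by apply: integrable_sum => // j _; exact: fi.
  by apply/funext => x; rewrite /= sumEFin.
transitivity (- \int[mu]_(x in affine x0 B @^-1` O) pg (affine x0 B x)); last first.
  congr (- _); apply: eq_Rintegral => x _; rewrite mxE mulr_suml.
  by apply: eq_bigr => j _; rewrite mxE Ephi mulrA.
rewrite (Rintegral_affine_cV x0 uB mO (intS _ int1)).
rewrite (Rintegral_affine_cV x0 uB mO (intS _ int2)).
rewrite -mulrN; congr (_ * _); rewrite !Rintegral_sum// -sumrN.
apply: eq_bigr => j _; rewrite !RintegralZl//.
- by rewrite (wg phi tphi j) mulrN.
- exact: (@test_functionM_integrable (fun y => g y j ord0)).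
- exact: test_function_deriveM_integrable.
Qed.

Lemma L2_grad_comp_affine (x0 : 'cV[R]_n) (B : 'M[R]_n) (g : 'cV[R]_n -> 'cV[R]_n) i :
  B \in unitmx -> (forall i, L2 O (fun x => g x i ord0)) ->
  L2 (affine x0 B @^-1` O) (fun x => (B^T *m g (affine x0 B x)) i ord0).
Proof.
move=> uB Lg.
rewrite (_ : (fun x => _) = (fun y => \sum_(j < n) B j i * g y j ord0) \o affine x0 B);
    last first.
  by apply/funext => x; rewrite /= mxE; apply: eq_bigr => j _; rewrite mxE.
by apply: L2_comp_affine => //; apply: L2_sum => // j; exact: L2Z.
Qed.

Definition H1_comp_affine (x0 : 'cV[R]_n) (B : 'M[R]_n) (uB : B \in unitmx)
    (w : H1 O) : H1 (affine x0 B @^-1` O) :=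
  MkH1 (L2_comp_affine x0 uB mO (H1_L2 w))
    (fun i => L2_grad_comp_affine x0 i uB (H1_grad_L2 w))
    (weak_gradient_comp_affine (x0 := x0) uB (H1_L2 w) (H1_grad_L2 w)
      (H1_weak_gradient w)).

Lemma weak_gradient0 : weak_gradient O (cst 0) (cst 0).
Proof.
move=> phi _ i; under eq_Rintegral do rewrite mul0r.
by under [in RHS]eq_Rintegral do rewrite mxE mul0r; rewrite Rintegral_cst// mul0r oppr0.
Qed.

Lemma L2_grad0 i : L2 O (fun x => (cst 0 x : 'cV[R]_n) i ord0).
Proof.
by rewrite (_ : (fun x => _) = cst 0); [exact: L2_cst|apply/funext => x; rewrite mxE].
Qed.

Definition H1_zero : H1 O := MkH1 (L2_cst 0 mO Ofin) L2_grad0 weak_gradient0.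

End H1_constructions.

(** * Slobodeckij seminorm under an affine map *)

Section slobodeckij.
Context {R : realType} {n : nat}.
Local Notation mu := (lebesgue_cV R n).
Implicit Types (O : set 'cV[R]_n) (v : 'cV[R]_n -> R).

Lemma measurable_enorm : measurable_fun [set: 'cV[R]_n] (@enorm R n).
Proof.
apply: (measurableT_comp (f := @Num.sqrt R)).
  by apply: continuous_measurable_fun; exact: sqrt_continuous.
apply: measurable_sum => i; apply: measurable_funM; exact: measurable_coor.
Qed.

Definition slobodeckij_kernel (s : R) v (z : 'cV[R]_n * 'cV[R]_n) : \bar R :=
  (`|v z.1 - v z.2| ^+ 2 / enorm (z.1 - z.2) `^ (n%:R + 2 * s))%:E.

Lemma slobodeckij_kernel_ge0 s v z : (0 <= slobodeckij_kernel s v z)%E.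
Proof. by rewrite lee_fin mulr_ge0 ?invr_ge0 ?powR_ge0 ?sqr_ge0. Qed.

Lemma sqr_slobodeckij s O v : (slobodeckij_seminorm s O v ^+ 2 =
  \int[mu]_(x in O) \int[mu]_(y in O) slobodeckij_kernel s v (x, y))%E.
Proof.
rewrite sqr_sqrte//; apply: integral_ge0 => x _; apply: integral_ge0 => y _.
exact: (slobodeckij_kernel_ge0 s v (x, y)).
Qed.

Lemma measurable_slobodeckij_kernel s O v : measurable O -> measurable_fun O v ->
  measurable_fun (O `*` O) (slobodeckij_kernel s v).
Proof.
move=> mO mv; apply/measurable_EFinP.
have mOO : measurable (O `*` O) by exact: measurableX.
have m1 : measurable_fun (O `*` O) (fun z : 'cV[R]_n * 'cV[R]_n => v z.1).
  apply: (measurable_comp mO _ mv); first by move=> _ [z [? ?] <-].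
  exact: measurable_funTS measurable_fst.
have m2 : measurable_fun (O `*` O) (fun z : 'cV[R]_n * 'cV[R]_n => v z.2).
  apply: (measurable_comp mO _ mv); first by move=> _ [z [? ?] <-].
  exact: measurable_funTS measurable_snd.
apply: measurable_funM.
  by apply: measurable_funX; apply: measurableT_comp => //; exact: measurable_funB.
under eq_fun do rewrite -powRN.
apply: measurable_funTS; apply: (measurableT_comp (measurable_powR _)).
apply: (measurableT_comp measurable_enorm); apply: measurable_fun_coorP => i.
under eq_fun do rewrite !mxE.
by apply: measurable_funB; apply: (measurableT_comp (measurable_coor i)).
Qed.

(** Tonelli measurability for the extension of [k] by zero; for x in O a slice of the extension is
    the extension of the slice. *)
Lemma measurable_partial_integral O (k : 'cV[R]_n * 'cV[R]_n -> \bar R) :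
  measurable O -> measurable_fun (O `*` O) k -> (forall z, 0 <= k z)%E ->
  (forall x, O x -> measurable_fun O (fun y => k (x, y))) /\
  measurable_fun O (fun x => \int[mu]_(y in O) k (x, y))%E.
Proof.
move=> mO mk k0.
have mOO : measurable (O `*` O) by exact: measurableX.
pose kT := k \_ (O `*` O).
have mkT : measurable_fun setT kT by exact/(measurable_restrictT _ _).1.
have kT0 z : (0 <= kT z)%E by exact: erestrict_ge0.
have E x : O x -> (fun y => kT (x, y)) = (fun y => k (x, y)) \_ O.
  move=> Ox; apply/funext => y; rewrite /kT /patch in_setX/= mem_set//=.
split.
  move=> x Ox; apply/(measurable_restrictT _ _).2 => //; rewrite -E//.
  by apply: (measurableT_comp mkT).
apply: (eq_measurable_fun (fubini_F mu kT)).
  move=> x; rewrite inE => Ox; rewrite /fubini_F [in RHS]integral_mkcond.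
  by apply: eq_integral => y _; rewrite -E.
apply: measurable_funTS; exact: measurable_fun_fubini_tonelli_F.
Qed.

(** The numerators agree, and |F x - F y| = |B (x - y)| <= ||B|| |x - y| compares the denominators,
    which are nonzero together as B is injective. *)
Lemma slobodeckij_kernel_comp_affine s v (x0 : 'cV[R]_n) (B : 'M[R]_n) x y :
  0 < s -> B \in unitmx -> (slobodeckij_kernel s (v \o affine x0 B) (x, y) <=
    (opnorm B `^ (n%:R + 2 * s))%:E *
    slobodeckij_kernel s v (affine x0 B x, affine x0 B y))%E.
Proof.
move=> s0 uB; rewrite -EFinM lee_fin /= mulrCA ler_wpM2l ?sqr_ge0//.
set p := n%:R + 2 * s.
have p0 : 0 < p by rewrite ltr_wpDl// mulr_gt0.
have -> : affine x0 B x - affine x0 B y = B *m (x - y).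
  by rewrite /affine mulmxBr opprD addrACA subrr add0r.
(* On the diagonal the left side is 0, since 0 to the positive power [p] is 0 and the inverse of 0
   is 0. *)
have [xy|xy] := eqVneq (enorm (x - y)) 0.
  rewrite xy powR0 ?gt_eqF// invr0 mulr_ge0 ?powR_ge0// invr_ge0 powR_ge0//.
have a0 : 0 < enorm (x - y) by rewrite lt_def xy enorm_ge0.
have b0 : 0 < enorm (B *m (x - y)).
  rewrite lt_def enorm_ge0 andbT; apply: contra_neq xy => /enorm_eq0 h.
  by rewrite -[x - y](mulKmx uB) h mulmx0 enorm0.
rewrite -[leLHS]mul1r ler_pdivrMr; last exact: powR_gt0.
rewrite mulrAC ler_pdivlMr; last exact: powR_gt0.
rewrite mul1r.
rewrite -powRM ?opnorm_ge0 ?enorm_ge0//.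
apply: ge0_ler_powR; rewrite ?nnegrE ?enorm_ge0 ?(ltW p0)//.
  by rewrite mulr_ge0 ?opnorm_ge0 ?enorm_ge0.
exact: enorm_mulmx.
Qed.

(** Each of the two integrations contributes one factor |det B|^-1. *)
Lemma double_integral_affine_le O (x0 : 'cV[R]_n) (B : 'M[R]_n)
    (k kh : 'cV[R]_n * 'cV[R]_n -> \bar R) (b : R) (F := affine x0 B) :
  B \in unitmx -> measurable O -> 0 <= b ->
  (forall z, 0 <= k z)%E -> (forall z, 0 <= kh z)%E ->
  measurable_fun (O `*` O) k ->
  measurable_fun (F @^-1` O `*` F @^-1` O) kh ->
  (forall x y, kh (x, y) <= b%:E * k (F x, F y))%E ->
  (\int[mu]_(x in F @^-1` O) \int[mu]_(y in F @^-1` O) kh (x, y) <=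
   (b * `|\det B|^-1 ^+ 2)%:E * \int[mu]_(x in O) \int[mu]_(y in O) k (x, y))%E.
Proof.
move=> uB mO b0 k0 kh0 mk mkh khk.
set c := `|\det B|^-1.
have c0 : 0 <= c by rewrite invr_ge0.
have mOh : measurable (F @^-1` O) by exact: measurable_affine_preimage.
have [{}mk mK] := measurable_partial_integral mO mk k0.
have [{}mkh mKh] := measurable_partial_integral mOh mkh kh0.
pose K x := (\int[mu]_(y in O) k (x, y))%E.
have K0 x : (0 <= K x)%E by exact: integral_ge0.
have mKF : measurable_fun (F @^-1` O) (K \o F) by exact: measurable_comp_affine.
apply: (@le_trans _ _ (\int[mu]_(x in F @^-1` O) ((b * c)%:E * (K \o F) x))%E).
  apply: ge0_le_integral => //.
  - by move=> x _; exact: integral_ge0.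
  - by apply: measurable_funeM.
  move=> x Ox; rewrite /= EFinM -muleA.
  rewrite -(ge0_integral_affine_cV x0 uB (f := fun y => k (F x, y)) mO (mk _ Ox) (fun y
      _ => k0 _)).
  have mkF : measurable_fun (F @^-1` O) (fun y => k (F x, F y)).
    exact: (measurable_comp_affine mO (mk _ Ox)).
  rewrite -(ge0_integralZl _ mOh mkF (fun y _ => k0 _)) ?lee_fin//.
  apply: ge0_le_integral => //; first exact: mkh.
  exact: measurable_funeM.
rewrite (ge0_integralZl _ mOh mKF (fun y _ => K0 _)) ?lee_fin ?mulr_ge0//.
rewrite [X in (_ * X)%E](ge0_integral_affine_cV x0 uB mO mK (fun x _ => K0 x)).
by rewrite muleA -EFinM expr2 mulrA.
Qed.

Lemma sqr_slobodeckij_comp_affine s O v (x0 : 'cV[R]_n) (B : 'M[R]_n) :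
  0 < s -> B \in unitmx -> measurable O -> measurable_fun O v ->
  (slobodeckij_seminorm s (affine x0 B @^-1` O) (v \o affine x0 B) ^+ 2 <=
   (opnorm B `^ (n%:R + 2 * s) * `|\det B|^-1 ^+ 2)%:E *
   slobodeckij_seminorm s O v ^+ 2)%E.
Proof.
move=> s0 uB mO mv; rewrite [leLHS]sqr_slobodeckij [X in (_ <= _ * X)%E]sqr_slobodeckij.
apply: double_integral_affine_le => //.
- exact: powR_ge0.
- exact: slobodeckij_kernel_ge0.
- exact: slobodeckij_kernel_ge0.
- exact: measurable_slobodeckij_kernel.
- apply: measurable_slobodeckij_kernel; first exact: measurable_affine_preimage.
  exact: measurable_comp_affine.
- by move=> x y; exact: slobodeckij_kernel_comp_affine.
Qed.

Lemma slobodeckij_addc s O v c :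
  slobodeckij_seminorm s O (fun x => v x + c) = slobodeckij_seminorm s O v.
Proof.
have vcE x y : v x + c - (v y + c) = v x - v y by rewrite opprD addrACA subrr addr0.
rewrite /slobodeckij_seminorm.
by under eq_integral => x _ do under eq_integral => y _ do rewrite vcE.
Qed.

End slobodeckij.

(** * K-functionals *)

Section K_functionals.
Context {R : realType} {n : nat} (O : set 'cV[R]_n).
Local Notation mu := (lebesgue_cV R n).
Hypotheses (mO : measurable O) (Ofin : (mu O < +oo)%E).
Implicit Types (v w : 'cV[R]_n -> R) (t : R).

Definition Kterm_seminorm t v0 (v1 : H1 O) : \bar R :=
  (l2norm O v0 ^+ 2 + (t ^+ 2)%:E * H1_seminorm v1 ^+ 2)%E.

Definition Kterm_norm t v0 (v1 : H1 O) : \bar R :=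
  (l2norm O v0 ^+ 2 + (t ^+ 2)%:E * H1_norm v1 ^+ 2)%E.

Lemma sqre_ge0 (x : \bar R) : (0 <= x)%E -> (0 <= x ^+ 2)%E.
Proof. by move=> x0; rewrite expe2 mule_ge0. Qed.

Lemma l2norm_ge0 v : (0 <= l2norm O v)%E. Proof. exact: sqrte_ge0. Qed.

Lemma sqr_H1_norm (w : H1 O) :
  (H1_norm w ^+ 2 = l2norm O w ^+ 2 + H1_seminorm w ^+ 2)%E.
Proof. by rewrite sqr_sqrte// adde_ge0 ?sqre_ge0 ?sqrte_ge0. Qed.

Lemma Kfun_seminorm_le t v v0 (v1 : H1 O) : decomposition v v0 v1 ->
  (Kfun_seminorm t O v <= Kterm_seminorm t v0 v1)%E.
Proof. by move=> d; apply: ereal_inf_lbound; exists v0, v1. Qed.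

Lemma Kfun_norm_le t v v0 (v1 : H1 O) : decomposition v v0 v1 ->
  (Kfun_norm t O v <= Kterm_norm t v0 v1)%E.
Proof. by move=> d; apply: ereal_inf_lbound; exists v0, v1. Qed.

Lemma le_Kfun_seminorm t v (b : \bar R) :
  (forall v0 (v1 : H1 O), decomposition v v0 v1 -> b <= Kterm_seminorm t v0 v1)%E ->
  (b <= Kfun_seminorm t O v)%E.
Proof. by move=> h; apply: le_ereal_inf_tmp => _ [v0 [v1 [d ->]]]; exact: h. Qed.

Lemma le_Kfun_norm t v (b : \bar R) :
  (forall v0 (v1 : H1 O), decomposition v v0 v1 -> b <= Kterm_norm t v0 v1)%E ->
  (b <= Kfun_norm t O v)%E.
Proof. by move=> h; apply: le_ereal_inf_tmp => _ [v0 [v1 [d ->]]]; exact: h. Qed.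

Lemma Kterm_seminorm_ge0 t v0 (v1 : H1 O) : (0 <= Kterm_seminorm t v0 v1)%E.
Proof. by rewrite adde_ge0 ?mule_ge0 ?sqre_ge0 ?sqrte_ge0// lee_fin sqr_ge0. Qed.

Lemma Kterm_norm_ge0 t v0 (v1 : H1 O) : (0 <= Kterm_norm t v0 v1)%E.
Proof. by rewrite adde_ge0 ?mule_ge0 ?sqre_ge0 ?sqrte_ge0// lee_fin sqr_ge0. Qed.

Lemma Kfun_seminorm_ge0 t v : (0 <= Kfun_seminorm t O v)%E.
Proof. by apply: le_Kfun_seminorm => v0 v1 _; exact: Kterm_seminorm_ge0. Qed.

Lemma Kfun_norm_ge0 t v : (0 <= Kfun_norm t O v)%E.
Proof. by apply: le_Kfun_norm => v0 v1 _; exact: Kterm_norm_ge0. Qed.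

(** Serves to make the K-functional measurable in t. *)
Lemma Kfun_seminorm_nd v t t' : 0 <= t -> t <= t' ->
  (Kfun_seminorm t O v <= Kfun_seminorm t' O v)%E.
Proof.
move=> t0 tt'; apply: le_Kfun_seminorm => v0 v1 d.
apply: (le_trans (Kfun_seminorm_le t d)); rewrite leeD2l// lee_wpmul2r ?sqre_ge0
    ?sqrte_ge0//.
by rewrite lee_fin lerXn2r// nnegrE (le_trans t0).
Qed.

Lemma Kfun_norm_nd v t t' : 0 <= t -> t <= t' ->
  (Kfun_norm t O v <= Kfun_norm t' O v)%E.
Proof.
move=> t0 tt'; apply: le_Kfun_norm => v0 v1 d.
apply: (le_trans (Kfun_norm_le t d)); rewrite leeD2l// lee_wpmul2r ?sqre_ge0 ?sqrte_ge0//.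
by rewrite lee_fin lerXn2r// nnegrE (le_trans t0).
Qed.

Lemma Kfun_seminorm_le_norm t v : (Kfun_seminorm t O v <= Kfun_norm t O v)%E.
Proof.
apply: le_Kfun_norm => v0 v1 d; apply: (le_trans (Kfun_seminorm_le t d)).
rewrite leeD2l// lee_wpmul2l ?lee_fin ?sqr_ge0// sqr_H1_norm leeDr//.
exact/sqre_ge0/sqrte_ge0.
Qed.

(** The H^1 part absorbs the constant without changing its gradient. One inequality is enough, as it
    also applies to -c. *)
Lemma Kfun_seminorm_addc t v c :
  (Kfun_seminorm t O (fun x => v x + c)%R <= Kfun_seminorm t O v)%E.
Proof.
apply: le_Kfun_seminorm => v0 v1 [L0 vE].
rewrite -[Kterm_seminorm _ _ _]/(Kterm_seminorm t v0 (H1_addc mO Ofin c v1)).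
apply: Kfun_seminorm_le; split => //.
by apply: filterS vE => x h Ox; rewrite h//= addrA.
Qed.

(** The decomposition v = v + 0; the bound is uniform in t and is used for t > 1. *)
Lemma Kfun_norm_le_l2norm t v : L2 O v -> (Kfun_norm t O v <= l2norm O v ^+ 2)%E.
Proof.
move=> Lv; apply: (@le_trans _ _ (Kterm_norm t v (H1_zero mO Ofin))).
  apply: Kfun_norm_le; split => //.
  by apply: aeW => x _; rewrite /= addr0.
rewrite /Kterm_norm sqr_H1_norm.
have z (f : 'cV[R]_n -> R) : (forall x, f x = 0) -> l2norm O f = 0%E.
  move=> f0; rewrite /l2norm; under eq_integral do rewrite f0 expr0n.
  by rewrite integral0 sqrte0.
rewrite [l2norm O (H1_zero mO Ofin)]z//.
rewrite [H1_seminorm _]z => [|x]; last by rewrite /= enorm0.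
by rewrite -[(0 ^+ 2)%E]/(0 * 0)%E mule0 adde0 mule0 adde0.
Qed.

(** Put a, b, A for the squared L^2 norms of v0, v1, v and e for the squared gradient norm of v1.
    From b <= 2 A + 2 a and t <= 1 follows a + t^2 (b + e) <= 3 a + t^2 e + 2 t^2 A. *)
Lemma Kfun_norm_le_seminorm t v : L2 O v -> 0 < t -> t <= 1 ->
  (Kfun_norm t O v <= 3%:E * Kfun_seminorm t O v +
    (2 * t ^+ 2)%:E * l2norm O v ^+ 2)%E.
Proof.
move=> Lv t0 t1.
have finL2 w : L2 O w -> exists2 a : R, 0 <= a & (l2norm O w ^+ 2)%E = a%:E.
  move=> [_ wfin]; have w0 := l2norm_ge0 w.
  case: (l2norm O w) wfin w0 => // a _ a0.
  by exists (a ^+ 2); [exact: sqr_ge0|rewrite expe2 -EFinM expr2].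
have [A A0 EA] := finL2 v Lv; rewrite EA -EFinM.
(* Isolates the infimum on the right, using that A is finite, so that the bound can be checked for
   one decomposition at a time. *)
rewrite -leeBlDr// -lee_pdivrMl//.
apply: le_Kfun_seminorm => v0 v1 d; rewrite lee_pdivrMl// leeBlDr//.
apply: (le_trans (Kfun_norm_le t d)); rewrite /Kterm_norm /Kterm_seminorm sqr_H1_norm.
have [L0 vE] := d; have L1 := H1_L2 v1.
have [a a0 Ea] := finL2 v0 L0; have [b b0 Eb] := finL2 v1 L1.
have bA : b <= 2 * A + 2 * a.
  rewrite -lee_fin EFinD !EFinM -Ea -Eb -EA !sqr_l2norm.
  have m2 w : measurable_fun O w -> measurable_fun O (fun x => ((w x) ^+ 2)%:E).
    exact: measurable_sqr.
  have [mv _] := Lv; have [mv0 _] := L0; have [mv1 _] := L1.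
  rewrite -!ge0_integralZl//; try (exact: m2); try by move=> x _; rewrite lee_fin sqr_ge0.
  rewrite -ge0_integralD//; try (by apply: measurable_funeM; exact: m2);
    try by move=> x _; rewrite -EFinM lee_fin mulr_ge0 ?sqr_ge0.
  apply: ae_ge0_le_integral => //.
  - by move=> x _; rewrite lee_fin sqr_ge0.
  - exact: m2.
  - by move=> x _; rewrite -!EFinM -EFinD lee_fin addr_ge0// mulr_ge0 ?sqr_ge0.
  - by apply: emeasurable_funD; apply: measurable_funeM; exact: m2.
  apply: filterS vE => x h Ox; rewrite -!EFinM -EFinD lee_fin (h Ox).
  (* Indeed 2 (v0 + v1)^2 + 2 v0^2 - v1^2 = (2 v0 + v1)^2. *)
  have := sqr_ge0 (2 * v0 x + v1 x); rewrite !expr2; nra.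
rewrite Ea Eb.
have d0 : (0 <= H1_seminorm v1 ^+ 2)%E by apply: sqre_ge0; exact: sqrte_ge0.
(* An infinite gradient norm is not excluded here; the right side is then infinite, as t > 0. *)
case: (H1_seminorm v1 ^+ 2)%E d0 => [e|_|//].
  rewrite lee_fin => e0; rewrite -?(EFinD, EFinM) lee_fin.
  have t20 : 0 <= t ^+ 2 by exact: sqr_ge0.
  have t21 : t ^+ 2 <= 1 by rewrite expr_le1// ltW.
  nra.
by rewrite gt0_muley ?lte_fin ?exprn_gt0// addey// gt0_muley// addye// leey.
Qed.

End K_functionals.

(** * Interpolation seminorms and norms *)

Section K_functional_affine.
Context {R : realType} {n : nat} (O : set 'cV[R]_n).
Local Notation mu := (lebesgue_cV R n).
Hypotheses (mO : measurable O) (Ofin : (mu O < +oo)%E).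
Context (x0 : 'cV[R]_n) (B : 'M[R]_n).
Hypothesis uB : B \in unitmx.

Lemma measurable_enorm_grad (g : 'cV[R]_n -> 'cV[R]_n) :
  (forall i, measurable_fun O (fun x => g x i ord0)) ->
  measurable_fun O (enorm \o g).
Proof.
move=> mg; apply: (measurableT_comp (f := @Num.sqrt R)).
  by apply: continuous_measurable_fun; exact: sqrt_continuous.
by apply: measurable_sum => i; apply: measurable_funM.
Qed.

(** Pointwise |B^T g| <= ||B|| |g|, followed by the exact scaling of the L^2 norm of |g|. *)
Lemma sqr_H1_seminorm_comp_affine (w : H1 O) :
  (H1_seminorm (H1_comp_affine mO Ofin x0 uB w) ^+ 2 <=
   (`|\det B|^-1 * opnorm B ^+ 2)%:E * H1_seminorm w ^+ 2)%E.
Proof.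
set F := affine x0 B.
have mw : measurable_fun O (enorm \o H1_grad w).
  by apply: measurable_enorm_grad => i; case: (H1_grad_L2 w i).
have mOh : measurable (F @^-1` O) by exact: measurable_affine_preimage.
rewrite mulrC EFinM -muleA -(sqr_l2norm_comp_affine x0)// !sqr_l2norm.
rewrite -ge0_integralZl//; last 3 first.
- by apply: measurable_sqr; exact: measurable_comp_affine.
- by move=> x _; rewrite lee_fin sqr_ge0.
- by rewrite lee_fin sqr_ge0.
apply: ge0_le_integral => //.
- by move=> x _; rewrite lee_fin sqr_ge0.
- apply: measurable_sqr; set wh := H1_comp_affine _ _ _ _ _.
  apply: (measurableT_comp (f := @Num.sqrt R)).
    by apply: continuous_measurable_fun; exact: sqrt_continuous.
  apply: measurable_sum => i; have [mi _] := H1_grad_L2 wh i.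
  by apply: measurable_funM.
- apply: measurable_funeM; apply: measurable_sqr; exact: measurable_comp_affine.
- move=> x _; rewrite -EFinM lee_fin -exprMn lerXn2r ?nnegrE ?enorm_ge0//.
    by rewrite mulr_ge0 ?opnorm_ge0 ?enorm_ge0.
  exact: enorm_trmx.
Qed.

(** Each decomposition of [v] pulls back to one of the composite, over all of which the left side is
    an infimum. The factor ||B||^2 of the gradient term is absorbed into t^2. *)
Lemma Kfun_seminorm_comp_affine t v : measurable_fun O v ->
  (Kfun_seminorm t (affine x0 B @^-1` O) (v \o affine x0 B) <=
   `|\det B|^-1%:E * Kfun_seminorm (opnorm B * t) O v)%E.
Proof.
move=> mv; have d0 : 0 < `|\det B| by rewrite normr_gt0 -unitfE -unitmxE.
rewrite -lee_pdivrMl ?invr_gt0//; apply: le_Kfun_seminorm => v0 v1 [L0 vE].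
rewrite lee_pdivrMl ?invr_gt0//.
pose v1h := H1_comp_affine mO Ofin x0 uB v1.
apply: (@le_trans _ _ (Kterm_seminorm t (v0 \o affine x0 B) v1h)).
  apply: Kfun_seminorm_le; split; first exact: L2_comp_affine.
  have := ae_affine_cV x0 uB vE; apply: filterS => x h Ox; exact: h.
rewrite /Kterm_seminorm (sqr_l2norm_comp_affine x0)//; last by case: L0.
rewrite ge0_muleDr ?mule_ge0 ?sqre_ge0 ?sqrte_ge0 ?lee_fin ?sqr_ge0//.
rewrite leeD2l//; apply: (le_trans (lee_wpmul2l _ (sqr_H1_seminorm_comp_affine v1))).
  by rewrite lee_fin sqr_ge0.
have : (0 <= H1_seminorm v1 ^+ 2)%E by exact/sqre_ge0/sqrte_ge0.
move: (H1_seminorm v1 ^+ 2)%E => S S0.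
rewrite !muleA -!EFinM lee_wpmul2r// lee_fin le_eqVlt; apply/orP; left; apply/eqP.
by ring.
Qed.

End K_functional_affine.

Section interpolation.
Context {R : realType}.
Local Notation leb := (@lebesgue_measure R).
Local Notation D := (`]0%R, +oo[%classic : set R).
Implicit Types (s t a : R) (Phi : R -> \bar R).

Definition interp_integrand s Phi t : \bar R :=
  ((t `^ (- (2 * s)))%:E * Phi t * (t^-1)%:E)%E.

Lemma measurable_invr_pos : measurable_fun D (@GRing.inv R).
Proof.
apply: (eq_measurable_fun (fun t : R => t `^ (-1))).
  by move=> t; rewrite inE/= in_itv/= andbT => t0; rewrite powR_inv1 ?ltW.
by apply: measurable_funTS; exact: measurable_powR.
Qed.

(** The part of the half-line where Phi >= a is an interval, and the rays [a, +oo] generate the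
    sigma-algebra. *)
Lemma nondecreasing_ereal_measurable Phi :
  (forall t t', 0 < t -> t <= t' -> (Phi t <= Phi t')%E) -> measurable_fun D Phi.
Proof.
move=> ndPhi mD; apply: (measurability _ (ErealGenCInfty.measurableE R)) => //.
move=> _ [_ [a ->] <-]; apply: is_interval_measurable => x y [x0 ax] _ z /andP[xz zy].
move: x0; rewrite /= in_itv/= andbT => x0.
split; first by rewrite /= in_itv/= andbT (lt_le_trans x0).
move: ax; rewrite /= !in_itv/= !andbT => /le_trans; apply; exact: ndPhi.
Qed.

Lemma measurable_interp_integrand s Phi : measurable_fun D Phi ->
  measurable_fun D (interp_integrand s Phi).
Proof.
move=> mPhi; apply: emeasurable_funM; last first.
  by apply/measurable_EFinP; exact: measurable_invr_pos.
apply: emeasurable_funM => //; apply/measurable_EFinP.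
by apply: measurable_funTS; exact: measurable_powR.
Qed.

Lemma interp_integrand_ge0 s Phi t : D t -> (0 <= Phi t)%E ->
  (0 <= interp_integrand s Phi t)%E.
Proof.
rewrite /= in_itv/= andbT => t0 P0.
apply: mule_ge0; last by rewrite lee_fin invr_ge0 ltW.
by apply: mule_ge0 => //; rewrite lee_fin powR_ge0.
Qed.

Lemma interp_integrand_le s Phi Psi t : D t -> (0 <= Phi t)%E -> (Phi t <= Psi t)%E ->
  (interp_integrand s Phi t <= interp_integrand s Psi t)%E.
Proof.
rewrite /= in_itv/= andbT => t0 P0 PP.
apply: lee_wpmul2r; first by rewrite lee_fin invr_ge0 ltW.
by apply: lee_wpmul2l => //; rewrite lee_fin powR_ge0.
Qed.

(** Substitution of b t for t: dt/t is invariant and t^(-2s) releases b^(2s). *)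
Lemma integral_interp_scale s Phi b : 0 < b -> measurable_fun D Phi ->
  (forall t, 0 <= Phi t)%E ->
  (\int[leb]_(t in D) interp_integrand s (fun t => Phi (b * t)%R) t =
   (b `^ (2 * s))%:E * \int[leb]_(t in D) interp_integrand s Phi t)%E.
Proof.
move=> b0 mPhi P0; have mD : measurable D by exact: measurable_itv.
rewrite [LHS]integral_mkcond [in RHS]integral_mkcond.
set f := interp_integrand s Phi \_ D.
have mf : measurable_fun setT f.
  by apply/(measurable_restrictT _ _).1 => //; exact: measurable_interp_integrand.
have f0 x : (0 <= f x)%E.
  by apply: erestrict_ge0 => t Dt; exact: interp_integrand_ge0.
have b1 : b != 0 by rewrite gt_eqF.
(* The second factor b comes from t^-1 and cancels the Jacobian b^-1. *)
transitivity (\int[leb]_t ((b `^ (2 * s) * b)%:E * f (b * t + 0)%R))%E; last first.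
  rewrite ge0_integralZl//; last 2 first.
  - by apply: (measurableT_comp mf); apply: measurable_funD => //; exact: measurable_funM.
  - by rewrite lee_fin mulr_ge0 ?powR_ge0 ?ltW.
  rewrite ge0_integral_affine// muleA -EFinM; congr (_%:E * _)%E.
  by rewrite gtr0_norm// mulfK.
apply: eq_integral => t _; rewrite addr0 /f /patch.
have -> : (b * t \in D) = (t \in D).
  by apply/idP/idP; rewrite !inE/= !in_itv/= !andbT pmulr_rgt0.
case: ifPn => [|_]; last by rewrite mule0.
rewrite inE/= in_itv/= andbT => t0; rewrite /interp_integrand.
rewrite muleA muleA -!EFinM [in RHS]powRM ?ltW// invfM.
rewrite [RHS]muleAC -[LHS]muleAC -!EFinM; congr (_%:E * _)%E.
rewrite (powRN b); field.
by rewrite b1 !gt_eqF ?powR_gt0.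
Qed.

(** [a] may be negative, so the same formula serves near 0 and near infinity. *)
Lemma integral_powR a x y : a != 0 -> 0 < x -> x < y ->
  (\int[leb]_(t in `[x, y]) (t `^ (a - 1))%:E = ((y `^ a - x `^ a) / a)%:E)%E.
Proof.
move=> a0 x0 xy.
have pos t : x <= t -> t \in `]0, +oo[%R.
  by move=> xt; rewrite in_itv/= andbT (lt_le_trans x0).
have dP p t : x <= t -> derivable (@powR R ^~ p) t 1.
  by move=> /pos; exact: derivable_powR.
have cP p t : x <= t -> {for t, continuous (@powR R ^~ p)}.
  by move=> xt; apply/differentiable_continuous/derivable1_diffP/dP.
rewrite (@continuous_FTC2 _ _ (fun t => a^-1 * t `^ a))//.
- by rewrite -EFinB -mulrBr mulrC.
- apply: continuous_in_subspaceT => t; rewrite inE/= in_itv/= => /andP[xt _].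
  exact: cP.
- split.
  + by move=> t; rewrite in_itv/= => /andP[/ltW xt _]; apply: derivableM => //; exact: dP.
  + apply: cvg_at_right_filter; apply: cvgM; [exact: cvg_cst|exact: cP].
  + apply: cvg_at_left_filter; apply: cvgM; [exact: cvg_cst|apply: cP; exact: ltW].
- move=> t; rewrite in_itv/= => /andP[/ltW xt _].
  rewrite derive1Ml; last exact: dP.
  by rewrite powR_derive1 ?pos// mulrA mulVf// mul1r.
Qed.

End interpolation.

Section power_integrals.
Context {R : realType}.
Local Notation leb := (@lebesgue_measure R).
Implicit Types (a : R).

Lemma measurable_powR_EFin (A : set R) a :
  measurable_fun A (fun t : R => (t `^ a)%:E).
Proof.
by apply/measurable_EFinP; apply: measurable_funTS; exact: measurable_powR.
Qed.

(** Monotone convergence: a uniform bound on an increasing exhaustion bounds the improper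
    integral. *)
Lemma integral_bigcup_le (F : (set R)^nat) (A : set R) (f : R -> \bar R) (M : \bar R) :
  A `<=` \bigcup_i F i -> measurable A -> (forall i, measurable (F i)) ->
  nondecreasing_seq F -> measurable_fun [set: R] f -> (forall x, 0 <= f x)%E ->
  (forall i, \int[leb]_(x in F i) f x <= M)%E ->
  (\int[leb]_(x in A) f x <= M)%E.
Proof.
move=> AF mA mF ndF mf f0 FM.
apply: (@le_trans _ _ (\int[leb]_(x in \bigcup_i F i) f x)%E).
  apply: ge0_subset_integral => //; first exact: bigcupT_measurable.
  exact: measurable_funTS.
have mfF i : measurable_fun (F i) f by exact: measurable_funTS.
have cv := ge0_nondecreasing_set_cvg_integral (mu := leb) ndF mF mfF (fun i x _ => f0 x).
rewrite -(cvg_lim _ cv)//; apply: lime_le; first by apply/cvg_ex; eexists; exact: cv.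
by apply: nearW => i; exact: FM.
Qed.

Lemma integral_powR_01 a : 0 < a ->
  (\int[leb]_(t in `]0%R, 1%R]) (t `^ (a - 1))%:E <= (a^-1)%:E)%E.
Proof.
(* [k.+2] rather than [k.+1] keeps the interval nondegenerate, as [integral_powR] demands. *)
move=> a0; apply: (@integral_bigcup_le (fun k => `[k.+2%:R^-1, 1%R]%classic)) => //.
- move=> t /=; rewrite in_itv/= => /andP[t0 t1].
  have [k _ /(_ k (leqnn k)) /= kt] := near_infty_natSinv_lt (PosNum t0).
  exists k => //=; rewrite in_itv/= t1 andbT (le_trans _ (ltW kt))// lef_pV2 ?posrE//.
  by rewrite ler_nat.
- move=> k m km; apply/subsetPset => t /=; rewrite !in_itv/= => /andP[kt ->].
  by rewrite andbT (le_trans _ kt)// lef_pV2 ?posrE ?ltr0n// ler_nat.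
- exact: measurable_powR_EFin.
- by move=> t; rewrite lee_fin powR_ge0.
- move=> k; rewrite integral_powR ?gt_eqF// ?invf_lt1 ?ltr1n//.
  by rewrite lee_fin powR1 ler_pdivrMr// mulVf ?gt_eqF// gerBl powR_ge0.
Qed.

Lemma integral_powR_1y a : 0 < a ->
  (\int[leb]_(t in `]1%R, +oo[) (t `^ (- a - 1))%:E <= (a^-1)%:E)%E.
Proof.
move=> a0; apply: (@integral_bigcup_le (fun k => `[1%R, k.+2%:R]%classic)) => //.
- move=> t /=; rewrite in_itv/= andbT => t1.
  exists (Num.truncn t) => //=; rewrite in_itv/= (ltW t1)/=.
  by rewrite (le_trans (ltW (truncnS_gt t)))// ler_nat.
- move=> k m km; apply/subsetPset => t /=; rewrite !in_itv/= => /andP[-> tk].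
  by rewrite (le_trans tk)// ler_nat.
- exact: measurable_powR_EFin.
- by move=> t; rewrite lee_fin powR_ge0.
- move=> k; rewrite integral_powR ?oppr_eq0 ?gt_eqF// ?ltr1n//.
  by rewrite lee_fin powR1 invrN mulrN -mulNr opprB ler_pdivrMr// mulVf ?gt_eqF// gerBl
      powR_ge0.
Qed.

End power_integrals.

Section interpolation_norms.
Context {R : realType} {n : nat} (O : set 'cV[R]_n).
Local Notation mu := (lebesgue_cV R n).
Local Notation leb := (@lebesgue_measure R).
Local Notation D := (`]0%R, +oo[%classic : set R).
Hypotheses (mO : measurable O) (Ofin : (mu O < +oo)%E).
Implicit Types (v w : 'cV[R]_n -> R) (s t : R).

Lemma measurable_Kfun_seminorm v : measurable_fun D (fun t => Kfun_seminorm t O v).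
Proof.
apply: nondecreasing_ereal_measurable => t t' t0; apply: Kfun_seminorm_nd; exact: ltW.
Qed.

Lemma measurable_Kfun_norm v : measurable_fun D (fun t => Kfun_norm t O v).
Proof.
apply: nondecreasing_ereal_measurable => t t' t0; apply: Kfun_norm_nd; exact: ltW.
Qed.

Lemma sqr_interpolation_seminorm s v : (interpolation_seminorm s O v ^+ 2 =
  \int[leb]_(t in D) interp_integrand s (fun t => Kfun_seminorm t O v) t)%E.
Proof.
by rewrite sqr_sqrte//; apply: integral_ge0 => t Dt;
   exact: (@interp_integrand_ge0 R s (fun t => Kfun_seminorm t O v) t Dt
       (Kfun_seminorm_ge0 O t v)).
Qed.

Lemma sqr_interpolation_norm s v : (interpolation_norm s O v ^+ 2 =
  \int[leb]_(t in D) interp_integrand s (fun t => Kfun_norm t O v) t)%E.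
Proof.
by rewrite sqr_sqrte//; apply: integral_ge0 => t Dt;
   exact: (@interp_integrand_ge0 R s (fun t => Kfun_norm t O v) t Dt (Kfun_norm_ge0 O t
       v)).
Qed.

Lemma interpolation_le s (Phi Psi : R -> \bar R) :
  measurable_fun D Phi -> measurable_fun D Psi ->
  (forall t, 0 <= Phi t)%E -> (forall t, Phi t <= Psi t)%E ->
  (\int[leb]_(t in D) interp_integrand s Phi t <=
   \int[leb]_(t in D) interp_integrand s Psi t)%E.
Proof.
move=> mPhi mPsi P0 PP; apply: ge0_le_integral => //.
- by move=> t Dt; exact: interp_integrand_ge0.
- exact: measurable_interp_integrand.
- exact: measurable_interp_integrand.
- by move=> t Dt; exact: interp_integrand_le.
Qed.

Lemma sqr_interpolation_seminorm_le_norm s v :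
  (interpolation_seminorm s O v ^+ 2 <= interpolation_norm s O v ^+ 2)%E.
Proof.
rewrite (sqr_interpolation_seminorm s v) (sqr_interpolation_norm s v).
apply: interpolation_le.
- exact: measurable_Kfun_seminorm.
- exact: measurable_Kfun_norm.
- by move=> t; exact: Kfun_seminorm_ge0.
- by move=> t; exact: Kfun_seminorm_le_norm.
Qed.

Lemma sqr_interpolation_seminorm_addc s v c :
  (interpolation_seminorm s O (fun x => v x + c)%R ^+ 2 <=
   interpolation_seminorm s O v ^+ 2)%E.
Proof.
rewrite (sqr_interpolation_seminorm s v)
  (sqr_interpolation_seminorm s (fun x => v x + c)); apply: interpolation_le.
- exact: measurable_Kfun_seminorm.
- exact: measurable_Kfun_seminorm.
- by move=> t; exact: Kfun_seminorm_ge0.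
- by move=> t; exact: Kfun_seminorm_addc.
Qed.

(** The integral is split at t = 1. Below 1, the L^2 remainder 2 t^2 ||w||_0^2 integrates to
    ||w||_0^2/(1-s); above 1, the crude bound ||w||_0^2 integrates to ||w||_0^2/(2s). *)
Lemma sqr_interpolation_norm_le s w : 0 < s -> s < 1 -> L2 O w ->
  (interpolation_norm s O w ^+ 2 <= 3%:E * interpolation_seminorm s O w ^+ 2 +
    ((s * (1 - s))^-1)%:E * l2norm O w ^+ 2)%E.
Proof.
move=> s0 s1 Lw; rewrite (sqr_interpolation_norm s w) (sqr_interpolation_seminorm s w).
pose Ks t := Kfun_seminorm t O w; pose Kn t := Kfun_norm t O w.
have [A A0 EA] : exists2 A : R, 0 <= A & (l2norm O w ^+ 2)%E = A%:E.
  have [_] := Lw; have := l2norm_ge0 O w; case: (l2norm O w) => // A _ _.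
  by exists (A ^+ 2); [exact: sqr_ge0|rewrite expe2 -EFinM expr2].
have mn : measurable_fun D (interp_integrand s Kn).
  by apply: measurable_interp_integrand; exact: measurable_Kfun_norm.
have ms : measurable_fun D (interp_integrand s Ks).
  by apply: measurable_interp_integrand; exact: measurable_Kfun_seminorm.
have n0 t : D t -> (0 <= interp_integrand s Kn t)%E.
  by move=> Dt; exact: (@interp_integrand_ge0 R s Kn t Dt (Kfun_norm_ge0 O t w)).
have p0 t : D t -> (0 <= interp_integrand s Ks t)%E.
  by move=> Dt; exact: (@interp_integrand_ge0 R s Ks t Dt (Kfun_seminorm_ge0 O t w)).
have DE : D = `]0%R, 1%R]%classic `|` `]1%R, +oo[%classic.
  apply/seteqP; split => t /=; rewrite !in_itv/= !andbT.
    by move=> ->; have [|] := leP t 1; [left|right].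
  by case=> [/andP[]//|]; exact: lt_trans.
have sub1 : `]0%R, 1%R]%classic `<=` D by rewrite DE; left.
have sub2 : `]1%R, +oo[%classic `<=` D by rewrite DE; right.
have I1 : (\int[leb]_(t in `]0%R, 1%R]) interp_integrand s Kn t <=
    3%:E * (\int[leb]_(t in D) interp_integrand s Ks t) + ((1 - s)^-1 * A)%:E)%E.
  apply: (@le_trans _ _ (\int[leb]_(t in `]0%R, 1%R])
      (3%:E * interp_integrand s Ks t + (2 * A)%:E * (t `^ ((2 - 2 * s) - 1))%:E))%E).
    apply: ge0_le_integral => //.
    - by move=> t /sub1; exact: n0.
    - exact: measurable_funS mn.
    - apply: emeasurable_funD; apply: measurable_funeM; first exact: measurable_funS ms.
      exact: measurable_powR_EFin.
    move=> t t01; have Dt := sub1 _ t01.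
    move: t01; rewrite /= in_itv/= => /andP[t0 t1].
    have : (interp_integrand s Kn t <= interp_integrand s
        (fun t => 3%:E * Ks t + (2 * t ^+ 2)%:E * A%:E)%E t)%E.
      apply: interp_integrand_le => //; first exact: Kfun_norm_ge0.
      by rewrite -EA; exact: Kfun_norm_le_seminorm.
    move=> /le_trans; apply; rewrite /interp_integrand.
    rewrite ge0_muleDr ?mule_ge0 ?Kfun_seminorm_ge0//; last first.
      by rewrite lee_fin mulr_ge0 ?sqr_ge0.
    rewrite ge0_muleDl; last 2 first.
    - by rewrite mule_ge0 ?lee_fin ?powR_ge0// mule_ge0// Kfun_seminorm_ge0.
    - by rewrite -!EFinM lee_fin mulr_ge0 ?powR_ge0// mulr_ge0// mulr_ge0 ?sqr_ge0.
    rewrite leeD//; first by rewrite !muleA (muleC (_ `^ _)%:E).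
    rewrite -!EFinM lee_fin le_eqVlt; apply/orP; left; apply/eqP.
    rewrite (_ : 2 - 2 * s - 1 = - (2 * s) + 2%:R - 1); last by ring.
    rewrite 2?powRD ?(gt_eqF t0) ?implybT// powR_mulrn ?(ltW t0)// powR_inv1 ?(ltW t0)//.
    by ring.
  rewrite ge0_integralD//; last 4 first.
  - by move=> t /sub1 Dt; rewrite mule_ge0 ?p0.
  - by apply: measurable_funeM; exact: measurable_funS ms.
  - by move=> t _; rewrite -EFinM lee_fin !mulr_ge0 ?powR_ge0.
  - by apply: measurable_funeM; exact: measurable_powR_EFin.
  apply: leeD.
    rewrite ge0_integralZl//; last 2 first.
    - exact: measurable_funS ms.
    - by move=> t /sub1 Dt; rewrite p0.
    rewrite lee_wpmul2l//; apply: ge0_subset_integral => //.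
  rewrite ge0_integralZl//; last 3 first.
  - exact: measurable_powR_EFin.
  - by move=> t _; rewrite lee_fin powR_ge0.
  - by rewrite lee_fin mulr_ge0.
  apply: (le_trans (lee_wpmul2l _ (integral_powR_01 _))).
  - by rewrite lee_fin mulr_ge0.
  - by lra.
  rewrite -EFinM lee_fin le_eqVlt; apply/orP; left; apply/eqP.
  by field; lra.
have I2 : (\int[leb]_(t in `]1%R, +oo[) interp_integrand s Kn t <=
    ((2 * s)^-1 * A)%:E)%E.
  apply: (@le_trans _ _ (\int[leb]_(t in `]1%R, +oo[) (A%:E * (t `^ (- (2 * s) -
      1))%:E))%E).
    apply: ge0_le_integral => //.
    - by move=> t /sub2; exact: n0.
    - exact: measurable_funS mn.
    - by apply: measurable_funeM; exact: measurable_powR_EFin.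
    move=> t t1; have Dt := sub2 _ t1.
    move: t1; rewrite /= in_itv/= andbT => t1.
    have t0 : 0 < t by exact: lt_trans t1.
    have : (interp_integrand s Kn t <= interp_integrand s (cst A%:E) t)%E.
      apply: interp_integrand_le => //; first exact: Kfun_norm_ge0.
      by rewrite /= -EA; exact: Kfun_norm_le_l2norm.
    move=> /le_trans; apply; rewrite /interp_integrand/=.
    rewrite -!EFinM lee_fin le_eqVlt; apply/orP; left; apply/eqP.
    rewrite powRD; last by rewrite (gt_eqF t0) implybT.
    by rewrite powR_inv1 ?ltW//; ring.
  rewrite ge0_integralZl//; last 2 first.
  - exact: measurable_powR_EFin.
  - by move=> t _; rewrite lee_fin powR_ge0.
  apply: (le_trans (lee_wpmul2l _ (integral_powR_1y _))) => //.
    by lra.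
  by rewrite -EFinM mulrC.
rewrite DE ge0_integral_setU//; last 3 first.
- by rewrite -DE.
- by rewrite -DE.
- apply/disj_setPS => t [] /=; rewrite !in_itv/= andbT => /andP[_ t1] /(le_lt_trans t1).
  by rewrite ltxx.
rewrite -DE; apply: (le_trans (leeD I1 I2)).
rewrite EA -addeA leeD2l// -EFinM -EFinD lee_fin -mulrDl ler_wpM2r//.
(* The surplus 1/(2s) is given away for the simpler constant. *)
have -> : (1 - s)^-1 + (2 * s)^-1 = (s * (1 - s))^-1 - (2 * s)^-1.
  by field; lra.
by rewrite gerBl invr_ge0 mulr_ge0 ?ltW.
Qed.

End interpolation_norms.

(** * Comparison on the reference domain *)

Section Hs_spaces.
Context {R : realType} {n : nat} (O : set 'cV[R]_n).
Local Notation mu := (lebesgue_cV R n).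
Hypotheses (mO : measurable O) (Ofin : (mu O < +oo)%E).
Implicit Types (v w : 'cV[R]_n -> R) (s t : R).

Lemma sqr_Hs_norm s v :
  (Hs_norm s O v ^+ 2 = l2norm O v ^+ 2 + slobodeckij_seminorm s O v ^+ 2)%E.
Proof. by rewrite sqr_sqrte// adde_ge0 ?sqre_ge0 ?sqrte_ge0. Qed.

Lemma Hs_norm_ge0 s v : (0 <= Hs_norm s O v)%E. Proof. exact: sqrte_ge0. Qed.

Lemma HsP s v : Hs s O v <-> L2 O v /\ (Hs_norm s O v ^+ 2 < +oo)%E.
Proof.
by have := sqrte_lty (Hs_norm s O v ^+ 2); rewrite sqrte_sqr gee0_abs ?Hs_norm_ge0//
    /Hs => ->.
Qed.

Lemma sqr_l2norm_lty v : L2 O v -> (l2norm O v ^+ 2 < +oo)%E.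
Proof. by move=> /L2P[_]; rewrite sqr_l2norm. Qed.

Lemma Hs_addc s v c : Hs s O v -> Hs s O (fun x => v x + c).
Proof.
move=> /HsP[Lv]; rewrite sqr_Hs_norm => vfin.
have Lvc := L2D mO Lv (L2_cst c mO Ofin).
apply/HsP; split => //; rewrite sqr_Hs_norm slobodeckij_addc.
apply: lte_add_pinfty; first exact: sqr_l2norm_lty.
by apply: le_lt_trans vfin; rewrite leeDr// sqre_ge0// sqrte_ge0.
Qed.

Lemma exists_mean_zero v : L2 O v ->
  exists c, (\int[mu]_(x in O) (v x + c)%:E = 0)%E.
Proof.
move=> Lv; have iv := L2_integrable mO Ofin Lv.
(* The mean divides by the measure of O; on a null set any constant works. *)
have [m0|m0] := eqVneq (mu O) 0%E.
  exists 0; apply: null_set_integral => //; apply/measurable_EFinP.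
  by apply: measurable_funD => //; case: Lv.
have mfin : mu O \is a fin_num by rewrite ge0_fin_numE.
pose m := fine (mu O); pose I := fine (\int[mu]_(x in O) (v x)%:E)%E.
have mE : mu O = m%:E by rewrite /m fineK.
have IE : (\int[mu]_(x in O) (v x)%:E)%E = I%:E.
  by rewrite /I fineK//; apply: integrable_fin_num => //; exact: iv.
exists (- (I / m)); under eq_integral do rewrite EFinD.
rewrite integralD//; last exact: (L2_integrable mO Ofin (L2_cst _ mO Ofin)).
rewrite integral_cst// IE [X in (_ * X)%E]mE -EFinM -EFinD mulNr divfK ?subrr//.
by apply: contra_neq m0 => m0; rewrite mE m0.
Qed.

End Hs_spaces.

(** * Scaling of norms and seminorms under an affine map *)

Section pullback.
Context {R : realType} {n : nat} (O : set 'cV[R]_n).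
Local Notation mu := (lebesgue_cV R n).
Hypotheses (mO : measurable O) (Ofin : (mu O < +oo)%E).
Context (x0 : 'cV[R]_n) (B : 'M[R]_n).
Hypothesis uB : B \in unitmx.
Implicit Types (v w : 'cV[R]_n -> R) (s t : R).

(** With |det B|^-1 factored out, the L^2 part needs the constant 1 and the Slobodeckij part |det
    B|^-1 ||B||^(n+2s); the maximum covers both. *)
Lemma sqr_Hs_norm_comp_affine s v : 0 < s -> measurable_fun O v ->
  (Hs_norm s (affine x0 B @^-1` O) (v \o affine x0 B) ^+ 2 <=
   (`|\det B|^-1 * Num.max (`|\det B|^-1 * opnorm B `^ (n%:R + 2 * s)) 1)%:E *
   Hs_norm s O v ^+ 2)%E.
Proof.
move=> s0 mv; rewrite [leLHS]sqr_Hs_norm [X in (_ <= _ * X)%E]sqr_Hs_norm.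
have a0 : (0 <= l2norm O v ^+ 2)%E by exact/sqre_ge0/sqrte_ge0.
have b0 : (0 <= slobodeckij_seminorm s O v ^+ 2)%E by exact/sqre_ge0/sqrte_ge0.
rewrite sqr_l2norm_comp_affine// ge0_muleDr//; apply: leeD.
  rewrite lee_wpmul2r// lee_fin ler_peMr ?invr_ge0//.
  by rewrite le_max lexx orbT.
apply: (le_trans (sqr_slobodeckij_comp_affine x0 s0 uB mO mv)).
rewrite lee_wpmul2r// lee_fin mulrC expr2 -mulrA ler_wpM2l ?invr_ge0//.
by rewrite le_max lexx.
Qed.

Lemma Hs_comp_affine s v : 0 < s -> Hs s O v ->
  Hs s (affine x0 B @^-1` O) (v \o affine x0 B).
Proof.
move=> s0 /HsP[Lv vfin]; apply/HsP; split; first exact: L2_comp_affine.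
have [mv _] := Lv.
apply: (le_lt_trans (sqr_Hs_norm_comp_affine s0 mv)).
by rewrite lte_mul_pinfty// lee_fin mulr_ge0 ?invr_ge0// le_max ler01 orbT.
Qed.

Lemma sqr_interpolation_seminorm_comp_affine s v : (0 < n)%N -> measurable_fun O v ->
  (interpolation_seminorm s (affine x0 B @^-1` O) (v \o affine x0 B) ^+ 2 <=
   (`|\det B|^-1 * opnorm B `^ (2 * s))%:E * interpolation_seminorm s O v ^+ 2)%E.
Proof.
move=> n0 mv; rewrite (sqr_interpolation_seminorm O s v)
  (sqr_interpolation_seminorm _ s (v \o affine x0 B)) EFinM -muleA.
have b0 : 0 < opnorm B by exact: opnorm_gt0.
have K0 t : (0 <= Kfun_seminorm t O v)%E := Kfun_seminorm_ge0 O t v.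
have mK := measurable_Kfun_seminorm O v.
have mKs : measurable_fun (`]0, +oo[%classic : set R)
    (fun t => Kfun_seminorm (opnorm B * t) O v).
  apply: nondecreasing_ereal_measurable => t t' t0 tt'; apply: Kfun_seminorm_nd.
    by rewrite mulr_ge0// ltW.
  by rewrite ler_wpM2l// ltW.
rewrite -(integral_interp_scale s b0 mK K0) -ge0_integralZl//; last 2 first.
- exact: (measurable_interp_integrand s mKs).
- by move=> t Dt; exact: (interp_integrand_ge0 s Dt (K0 _)).
apply: ge0_le_integral => //.
- move=> t Dt; exact: (@interp_integrand_ge0 _ s (fun t => Kfun_seminorm t _ _) t Dt
    (Kfun_seminorm_ge0 _ _ _)).
- exact: (measurable_interp_integrand s (measurable_Kfun_seminorm _ _)).
- by apply: measurable_funeM; exact: (measurable_interp_integrand s mKs).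
move=> t Dt; apply: (le_trans (@interp_integrand_le _ s (fun t => Kfun_seminorm t _ _)
  (fun t => `|\det B|^-1%:E * Kfun_seminorm (opnorm B * t) O v)%E t Dt
  (Kfun_seminorm_ge0 _ _ _) (Kfun_seminorm_comp_affine mO Ofin x0 uB t mv))).
by rewrite /interp_integrand !muleA (muleC (_ `^ _)%:E).
Qed.

End pullback.

(** The quotient seminorm squares an infimum, while the estimates concern squares of its members.
    Taking roots first makes sqrt(X/C) a lower bound of [S]. *)
Lemma le_mul_sqr_ereal_inf (R : realType) (S : set (\bar R)) (X : \bar R) (C : R) :
  0 < C -> (0 <= X)%E -> (forall z, S z -> (0 <= z)%E /\ (X <= C%:E * z ^+ 2)%E) ->
  (X <= C%:E * ereal_inf S ^+ 2)%E.
Proof.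
move=> C0 X0 h; rewrite -lee_pdivrMl//.
have Y0 : (0 <= C^-1%:E * X)%E by rewrite mule_ge0// lee_fin invr_ge0 ltW.
have le_inf : (sqrte (C^-1%:E * X) <= ereal_inf S)%E.
  apply: le_ereal_inf_tmp => z /h[z0 Xz].
  rewrite -(gee0_abs z0) -sqrte_sqr lee_sqrt ?sqre_ge0//.
  by rewrite lee_pdivrMl.
rewrite -[leLHS]sqr_sqrte// !expe2.
by apply: lee_pmul => //; exact: sqrte_ge0.
Qed.

Theorem theorem3p3 (R : realType) (n : nat) (hn : (0 < n)%N)
    (Ohat : set 'cV[R]_n) (hOhat : lipschitz_domain Ohat)
    (x0 : 'cV[R]_n) (B : 'M[R]_n) (hB : B \in unitmx)
    (s : R) (hs0 : 0 < s) (hs1 : s < 1)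
    (k K CPF : R) (hkK : norm_equivalence_constants s Ohat k K)
    (hCPF : poincare_friedrichs_constant s Ohat CPF) :
  let O := affine x0 B @` Ohat in
  forall v : 'cV[R]_n -> R, Hs s O v ->
    (interpolation_seminorm s O v ^+ 2 <=
      (opnorm (invmx B) `^ (2 * s)
       * Num.max (`|\det B|^-1 * opnorm B `^ (n%:R + 2 * s)) 1
       * k ^- 2)%:E
      * quotient_seminorm s O v ^+ 2)%E
    /\
    (quotient_seminorm s O v ^+ 2 <=
      (opnorm B `^ (2 * s)
       * Num.max (`|\det B| * opnorm (invmx B) `^ (n%:R + 2 * s)) 1
       * K ^+ 2 * (3 + CPF ^+ 2 / (s * (1 - s))))%:E
      * interpolation_seminorm s O v ^+ 2)%E.
Proof.
move=> O v Hv.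
have [_ oOh _ bOh _] := hOhat.
have mOh : measurable Ohat by exact: open_measurable_cV.
have Ohfin := bounded_lebesgue_cV_fin bOh mOh.
set F := affine x0 B; pose y0 := - (invmx B *m x0).
pose G := affine y0 (invmx B).
have uBi : invmx B \in unitmx by rewrite unitmx_inv.
(* The change of variables is stated for preimages, so each domain is written as a preimage of the
   other. *)
have OE : O = G @^-1` Ohat.
  apply/seteqP; split => [_ [x Ox <-]|x Gx]; first by rewrite /preimage/= /G affineK.
  by exists (G x) => //; rewrite /G affineVK.
have OhE : Ohat = F @^-1` O.
  rewrite OE; apply/seteqP; split => x; rewrite /preimage/= /G /F affineK//.
have mO : measurable O by rewrite OE; exact: measurable_affine_preimage.
have Ofin : (lebesgue_cV R n O < +oo)%E.
  by rewrite OE lebesgue_cV_affine_preimage// lte_mul_pinfty// lee_fin invr_ge0.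
pose vh := v \o F.
have vE c : (fun x => v x + c) = (fun x => vh x + c) \o G.
  by apply/funext => x; rewrite /vh/= /F /G affineVK.
have Hvh c : Hs s Ohat (fun x => vh x + c).
  by rewrite OhE; exact: (Hs_comp_affine mO x0 hB hs0 (Hs_addc mO Ofin c Hv)).
have [Lv _] := Hv; have [mv _] := Lv.
have mvc c : measurable_fun O (fun x => v x + c) by exact: measurable_funD.
have mvh c : measurable_fun Ohat (fun x => vh x + c) by have [[]] := Hvh c.
have [k0 K0 kK] := hkK.
have bgt0 : 0 < opnorm B by exact: opnorm_gt0.
have b'gt0 : 0 < opnorm (invmx B) by exact: opnorm_gt0.
have d0 : 0 < `|\det B| by rewrite normr_gt0 -unitfE -unitmxE.
have detV : `|\det (invmx B)|^-1 = `|\det B| by rewrite det_inv normfV invrK.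
have max_gt0 (z : R) : 0 < Num.max z 1 by rewrite lt_max ltr01 orbT.
have IO c : (interpolation_seminorm s O (fun x => v x + c)%R ^+ 2 <=
    (`|\det B| * opnorm (invmx B) `^ (2 * s))%:E *
    interpolation_seminorm s Ohat (fun x => vh x + c)%R ^+ 2)%E.
  rewrite vE OE -detV; exact: sqr_interpolation_seminorm_comp_affine.
have IOh : (interpolation_seminorm s Ohat vh ^+ 2 <=
    (`|\det B|^-1 * opnorm B `^ (2 * s))%:E * interpolation_seminorm s O v ^+ 2)%E.
  rewrite [in leLHS]OhE; exact: sqr_interpolation_seminorm_comp_affine.
have NOh c : (Hs_norm s Ohat (fun x => vh x + c)%R ^+ 2 <=
    (`|\det B|^-1 *
     Num.max (`|\det B|^-1 * opnorm B `^ (n%:R + 2 * s)) 1)%:E * Hs_norm s O (fun x =>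
         v x + c)%R ^+ 2)%E.
  rewrite [in leLHS]OhE; exact: (sqr_Hs_norm_comp_affine mO x0 hB hs0 (mvc c)).
have NO c : (Hs_norm s O (fun x => v x + c)%R ^+ 2 <=
    (`|\det B| *
     Num.max (`|\det B| * opnorm (invmx B) `^ (n%:R + 2 * s)) 1)%:E * Hs_norm s Ohat
         (fun x => vh x + c)%R ^+ 2)%E.
  rewrite vE OE -detV; exact: (sqr_Hs_norm_comp_affine mOh y0 uBi hs0 (mvh c)).
have sqrM (a : R) (x : \bar R) : ((a%:E * x) ^+ 2 = (a ^+ 2)%:E * x ^+ 2)%E.
  by rewrite !expe2 muleACA -EFinM expr2.
have sqr_le (x y : \bar R) : (0 <= x -> x <= y -> x ^+ 2 <= y ^+ 2)%E.
  by move=> x0' xy; rewrite !expe2; exact: lee_pmul.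
split.
  apply: le_mul_sqr_ereal_inf.
  - by rewrite !mulr_gt0 ?powR_gt0 ?invr_gt0 ?exprn_gt0.
  - exact/sqre_ge0/sqrte_ge0.
  move=> _ [c _ <-]; split; first exact: Hs_norm_ge0.
  (* Reintroduces the arbitrary c of the quotient seminorm, to which the interpolation seminorm is
     insensitive. *)
  have E0 : v = (fun x => (v x + c) + - c) by apply/funext => x; rewrite addrK.
  rewrite [in leLHS]E0.
  apply: (le_trans (sqr_interpolation_seminorm_addc mO Ofin _ _ _)).
  apply: (le_trans (IO c)).
  have le1 : (interpolation_seminorm s Ohat (fun x => vh x + c)%R ^+ 2 <=
      (k ^- 2)%:E * Hs_norm s Ohat (fun x => vh x + c)%R ^+ 2)%E.
    apply: (le_trans (sqr_interpolation_seminorm_le_norm _ _ _)).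
    rewrite -lee_pdivrMl ?invr_gt0 ?exprn_gt0// invrK.
    have [kn _] := kK _ (Hvh c).
    apply: le_trans (sqr_le _ _ _ kn); last by rewrite mule_ge0 ?sqrte_ge0// lee_fin ltW.
    by rewrite sqrM.
  have c1 : (0 <= (`|\det B| * opnorm (invmx B) `^ (2 * s))%:E)%E.
    by rewrite lee_fin mulr_ge0 ?powR_ge0.
  apply: (le_trans (lee_wpmul2l c1 (le_trans le1 (lee_wpmul2l _ (NOh c))))).
    by rewrite lee_fin invr_ge0 exprn_ge0// ltW.
  have := sqre_ge0 (Hs_norm_ge0 O s (fun x => v x + c)).
  move: (Hs_norm _ _ _ ^+ 2)%E => S S0.
  rewrite !muleA -!EFinM lee_wpmul2r// lee_fin.
  (* The two constants are equal: |det B| from [IO] cancels |det B|^-1 from [NOh]. *)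
  rewrite le_eqVlt; apply/orP; left; apply/eqP; field.
  by rewrite !gt_eqF.
have Lvh : L2 Ohat vh.
  by have [+ _] := Hvh 0; congr L2; apply/funext => x; rewrite addr0.
(* For this c the integral term of the Poincare-Friedrichs inequality drops out; the same c bounds
   the infimum in the quotient seminorm. *)
have [c mean0] := exists_mean_zero mOh Ohfin Lvh.
pose w x := vh x + c; have Hw : Hs s Ohat w by exact: Hvh.
have [C0 hC] := hCPF.
have ss0 : 0 <= s * (1 - s) by rewrite mulr_ge0 ?subr_ge0 ?ltW.
set I := interpolation_seminorm s Ohat w.
have I0 : (0 <= I)%E by exact: sqrte_ge0.
have wC : (l2norm Ohat w ^+ 2 <= (CPF ^+ 2)%:E * I ^+ 2)%E.
  have := hC _ Hw; rewrite mean0 abse0 adde0 => h.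
  apply: (le_trans (sqr_le _ _ (sqrte_ge0 _) h)).
  by rewrite sqrM.
apply: (@le_trans _ _ (Hs_norm s O (fun x => v x + c)%R ^+ 2)%E).
  apply: sqr_le; last by apply: ereal_inf_lbound; exists c.
  by apply: le_ereal_inf_tmp => _ [c' _ <-]; exact: Hs_norm_ge0.
apply: (le_trans (NO c)).
have le1 : (Hs_norm s Ohat w ^+ 2 <=
    (K ^+ 2 * (3 + CPF ^+ 2 / (s * (1 - s))))%:E * I ^+ 2)%E.
  have [_ hK] := kK _ Hw.
  apply: (le_trans (sqr_le _ _ (sqrte_ge0 _) hK)).
  rewrite sqrM [leRHS](_ : _ = (K ^+ 2)%:E *
    ((3 + CPF ^+ 2 / (s * (1 - s)))%:E * I ^+ 2))%E; last by rewrite (muleA (K ^+ 2)%:E).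
  apply: lee_wpmul2l; first by rewrite lee_fin sqr_ge0.
  have [Lw _] := Hw.
  apply: (le_trans (sqr_interpolation_norm_le mOh Ohfin hs0 hs1 Lw)).
  have q0 : 0 <= (s * (1 - s))^-1 by rewrite invr_ge0.
  set q := (s * (1 - s))^-1 in q0 *.
  have Cq0 : (0 <= (CPF ^+ 2 * q)%:E)%E by rewrite lee_fin mulr_ge0 ?sqr_ge0.
  rewrite (EFinD 3 (CPF ^+ 2 * q)) ge0_muleDl// leeD2l//.
  rewrite (mulrC _ q) (EFinM q) -muleA; exact: lee_wpmul2l.
have c1 : (0 <= (`|\det B| *
    Num.max (`|\det B| * opnorm (invmx B) `^ (n%:R + 2 * s)) 1)%:E)%E by rewrite
        lee_fin mulr_ge0// ltW.
apply: (le_trans (lee_wpmul2l c1 le1)).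
have c2 : (0 <= (K ^+ 2 * (3 + CPF ^+ 2 / (s * (1 - s))))%:E)%E.
  by rewrite lee_fin mulr_ge0 ?sqr_ge0// addr_ge0// divr_ge0 ?sqr_ge0.
have le2 : (I ^+ 2 <= (`|\det B|^-1 * opnorm B `^ (2 * s))%:E * interpolation_seminorm
    s O v ^+ 2)%E.
  apply: le_trans IOh; exact: sqr_interpolation_seminorm_addc.
apply: (le_trans (lee_wpmul2l c1 (lee_wpmul2l c2 le2))).
have : (0 <= interpolation_seminorm s O v ^+ 2)%E by exact/sqre_ge0/sqrte_ge0.
move: (interpolation_seminorm s O v ^+ 2)%E => S S0.
rewrite !muleA -!EFinM lee_wpmul2r// lee_fin.
rewrite le_eqVlt; apply/orP; left; apply/eqP; field.
by rewrite !gt_eqF ?subr_gt0.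
Qed.
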